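(* Let $\mathcal A$ be a unital C$^*$-algebra, let $h_0=x_0+iy_0\in\mathcal H$ ($x_0,y_0$ selfadjoint), let $h(t)=x(t)+iy(t)$ ($x(t),y(t)$ selfadjoint) be a smooth curve in $\mathcal H$ with $h(0)=h_0$, and let $\zeta=\chi+i\Upsilon$ ($\chi,\Upsilon$ selfadjoint valued) be a smooth vector field defined on a neighbourhood of $h_0$ in $\mathcal H$. Then the covariant derivative of $\zeta$ along $h(t)$ at $t=0$, for the reductive connection of $\mathcal H$, is $$\frac{D\zeta}{dt}\Big|_{t=0}=\zeta'-Re\left(x'y_0^{-1}\Upsilon+y'y_0^{-1}\chi\right)+i\,Re\left(x'y_0^{-1}\chi-y'y_0^{-1}\Upsilon\right),$$ where $x',y',\zeta'$ denote the derivatives at $t=0$ of $x(t)$, $y(t)$, $\zeta(h(t))$, and $\chi,\Upsilon$ are evaluated at $h_0$.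
   Context: $Re(a)=\frac12(a+a^* )$, $Im(a)=\frac1{2i}(a-a^* )$, and $\mathcal H=\{h\in\mathcal A: Im(h)\text{ positive and invertible}\}$, open in $\mathcal A$, with tangent space $\mathcal A$ at every point. $\mathcal U(\theta_H)$ is the group of invertible elements of $M_2(\mathcal A)$ preserving the form $\theta_H(\mathbf x,\mathbf y)=\frac1i(x_1^*y_2-x_2^*y_1)$ on $\mathcal A^2$. It is a Banach-Lie group acting transitively on $\mathcal H$ by $\tilde g\cdot h=(g_{21}+g_{22}h)(g_{11}+g_{12}h)^{-1}$. With $J=\left(\begin{array}{cc}0&1\\ -1&0\end{array}\right)$, its Banach-Lie algebra is $\mathcal X=\mathcal X_{as}\oplus\mathcal X_s$, where $\mathcal X_{as}=\{\tilde\beta\in M_2(\mathcal A):\tilde\beta^*=-\tilde\beta,\ \tilde\beta J=J\tilde\beta\}$ is the Lie algebra of the isotropy group of $i\in\mathcal H$ and $\mathcal X_s=\{\tilde\gamma\in M_2(\mathcal A):\tilde\gamma^*=\tilde\gamma,\ \tilde\gamma J=-J\tilde\gamma\}$ is the horizontal space at $i$. For $h\in\mathcal H$ and $\tilde b\in\mathcal U(\theta_H)$ with $\tilde b\cdot i=h$, the horizontal space at $h$ is $\tilde b\mathcal X_s\tilde b^{-1}$ (independent of the choice of $\tilde b$). The $1$-form of the reductive connection at $h$ is the real-linear map $\kappa_h:\mathcal A\to\tilde b\mathcal X_s\tilde b^{-1}$ that inverts the restriction to the horizontal space at $h$ of the differential at $1$ of $\tilde g\mapsto\tilde g\cdot h$.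 The covariant derivative of the reductive connection is determined by $$\kappa_{h_0}\left(\frac{D\zeta}{dt}\Big|_{t=0}\right)=\frac{d}{dt}\Big|_{t=0}\kappa_{h(t)}(\zeta(h(t)))+\left[\kappa_{h_0}(\zeta(h_0)),\kappa_{h_0}(h'(0))\right],$$ where $[\cdot,\cdot]$ is the commutator in $M_2(\mathcal A)$. *)

(* Defs.v *)
From HB Require Import structures.
From mathcomp Require Import all_boot all_order all_algebra.
From mathcomp Require Import complex.
From mathcomp Require Import all_classical all_reals all_analysis.

Set Implicit Arguments.
Unset Strict Implicit.
Unset Printing Implicit Defensive.

Import Order.TTheory GRing.Theory Num.Theory.
Import numFieldNormedType.Exports.

Local Open Scope classical_set_scope.
Local Open Scope ring_scope.

(* Unital C*-algebras (with 1 != 0) over R[i].  The norm is a plain real-valued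
   function because Hierarchy Builder does not allow a structure that joins
   unitRingType and normedModType but is not a numDomainType; the normed space
   structure is recovered with [banach] below.  As in every unitRingType, a^-1
   is the inverse of a when a is invertible, and a otherwise. *)
HB.mixin Record isCStarAlgebra (R : realType) A of GRing.UnitAlgebra R[i] A := {
  cstar_norm : A -> R ;
  cstar_normD : forall a b : A,
    cstar_norm (a + b) <= cstar_norm a + cstar_norm b ;
  cstar_normZ : forall (z : R[i]) (a : A),
    cstar_norm (z *: a) = Normc.normc z * cstar_norm a ;
  cstar_norm0_eq0 : forall a : A, cstar_norm a = 0 -> a = 0 ;
  cstar_normM : forall a b : A,
    cstar_norm (a * b) <= cstar_norm a * cstar_norm b ;
  cstar_complete : forall u : nat -> A,
    (forall e : R, 0 < e -> exists N : nat, forall m n : nat,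
       (N <= m)%N -> (N <= n)%N -> cstar_norm (u m - u n) < e) ->
    exists l : A, forall e : R, 0 < e -> exists N : nat, forall n : nat,
      (N <= n)%N -> cstar_norm (u n - l) < e ;
  star : A -> A ;
  starD : forall a b : A, star (a + b) = star a + star b ;
  starZ : forall (z : R[i]) (a : A), star (z *: a) = z^* *: star a ;
  starM : forall a b : A, star (a * b) = star b * star a ;
  starK : forall a : A, star (star a) = a ;
  cstar_identity : forall a : A, cstar_norm (star a * a) = cstar_norm a ^+ 2
}.

#[short(type="cstarAlgType")]
HB.structure Definition CStarAlgebra (R : realType) :=
  {A of GRing.UnitAlgebra R[i] A & isCStarAlgebra R A}.

(* The real Banach space underlying a C*-algebra; all derivatives are real
   derivatives in this space. *)
Definition banach (R : realType) (A : cstarAlgType R) : Type := A.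

Section Banach.
Variables (R : realType) (A : cstarAlgType R).
Local Notation V := (banach A).

HB.instance Definition _ := GRing.Zmodule.on V.

Definition real_scale (r : R) (a : V) : V := real_complex R r *: (a : A).

Fact real_scaleA (r s : R) (a : V) :
  real_scale r (real_scale s a) = real_scale (r * s) a.
Proof. by rewrite /real_scale scalerA rmorphM. Qed.

Fact real_scale1 : left_id 1 real_scale.
Proof. by move=> a; rewrite /real_scale rmorph1 scale1r. Qed.

Fact real_scaleDr : right_distributive real_scale +%R.
Proof. by move=> r a b; rewrite /real_scale scalerDr. Qed.

Fact real_scaleDl (a : V) : {morph real_scale^~ a : r s / r + s}.
Proof. by move=> r s; rewrite /real_scale rmorphD scalerDl. Qed.

HB.instance Definition _ := GRing.Zmodule_isLmodule.Build R V
  real_scaleA real_scale1 real_scaleDr real_scaleDl.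

Fact real_normD (a b : V) :
  cstar_norm (a + b : A) <= cstar_norm (a : A) + cstar_norm (b : A).
Proof. exact: cstar_normD. Qed.

Fact real_normZ (r : R) (a : V) :
  cstar_norm (r *: a : V) = `|r| * cstar_norm (a : A).
Proof.
by rewrite [LHS]cstar_normZ /Normc.normc /= expr0n addr0 sqrtr_sqr.
Qed.

Fact real_norm0_eq0 (a : V) : cstar_norm (a : A) = 0 -> a = 0.
Proof. exact: cstar_norm0_eq0. Qed.

HB.instance Definition _ := Lmodule_isNormed.Build R V
  real_normD real_normZ real_norm0_eq0.

End Banach.

(* Frechet C^oo maps on an open set W of a real normed space: [D x s] is the
   derivative of order [size s] of [f] at [x], a bounded multilinear map, applied
   to the vectors of [s].  The last condition says that the derivative of order
   n+1 is the Frechet derivative of the derivative of order n, in operator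
   norm. *)
Definition smooth_on (R : realType) (V E : normedModType R) (W : set V)
    (f : V -> E) : Prop :=
  exists D : V -> seq V -> E, forall x, W x ->
    [/\ D x [::] = f x,
        forall s1 s2 (r : R) u v,
          D x (s1 ++ (r *: u + v) :: s2) =
          r *: D x (s1 ++ u :: s2) + D x (s1 ++ v :: s2),
        forall n, exists C : R, forall s, size s = n ->
          `|D x s| <= C * \prod_(v <- s) `|v|
      & forall n (e : R), 0 < e -> \forall u \near (0 : V), forall s,
          size s = n ->
          `|D (x + u) s - D x s - D x (u :: s)| <=
          e * `|u| * \prod_(v <- s) `|v| ].

Section SiegelHalfSpace.
Variables (R : realType) (A : cstarAlgType R).
Implicit Types (a h v : A) (g X Y : 'M[A]_2).

Definition selfadjoint a : Prop := star a = a.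

Definition cRe a : A := (2%:R : R[i])^-1 *: (a + star a).
Definition cIm a : A := (2%:R * 'i : R[i])^-1 *: (a - star a).

(* In R[i], [0 <= z] means that z is a nonnegative real. *)
Definition positive a : Prop :=
  selfadjoint a /\ forall z : R[i], a - z%:A \isn't a GRing.unit -> 0 <= z.

Definition siegel : set A :=
  [set h | positive (cIm h) /\ cIm h \is a GRing.unit].

Definition theta_H (p q : 'cV[A]_2) : A :=
  ('i : R[i])^-1 *: (star (p 0 0) * q 1 0 - star (p 1 0) * q 0 0).

Definition U_theta : set 'M[A]_2 :=
  [set g | (exists g', g * g' = 1 /\ g' * g = 1) /\
           forall p q : 'cV[A]_2, theta_H (g *m p) (g *m q) = theta_H p q].

Definition moebius_denom g h : A := g 0 0 + g 0 1 * h.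

Definition moebius g h : A := (g 1 0 + g 1 1 * h) * (moebius_denom g h)^-1.

Definition adjoint_mx g : 'M[A]_2 := (map_mx star g)^T.

Definition J : 'M[A]_2 :=
  \matrix_(i, j) if (i == 0) && (j == 1) then 1
                 else if (i == 1) && (j == 0) then -1 else 0.

Definition X_s : set 'M[A]_2 :=
  [set X | adjoint_mx X = X /\ X * J = - (J * X)].

(* The space b X_s b^-1 for some b in U_theta with b . i = h.  The denominator
   of b . i is invertible for every b in U_theta; this is recorded since the
   inverse of a noninvertible element has no meaning. *)
Definition horizontal h : set 'M[A]_2 :=
  [set X | exists b b' Z : 'M[A]_2,
     [/\ U_theta b, b * b' = 1 /\ b' * b = 1,
         moebius_denom b ('i)%:A \is a GRing.unit /\ moebius b ('i)%:A = h,
         X_s Z & X = b * Z * b']].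

(* Derivative of a curve in M_2(A), for the product topology. *)
Definition mx_is_derive (g : R -> 'M[A]_2) (t : R) X : Prop :=
  forall i j, is_derive t (1 : R) (fun s => g s i j : banach A) (X i j).

(* The differential at 1 of the map g |-> g . h on U_theta sends X to v: the
   tangent vector X is the velocity at 1 of a curve g in U_theta, and v is the
   velocity of g . h. *)
Definition orbit_differential h X v : Prop :=
  exists g : R -> 'M[A]_2,
    [/\ \forall t \near (0 : R), U_theta (g t), g 0 = 1, mx_is_derive g 0 X
      & is_derive (0 : R) (1 : R) (fun t => moebius (g t) h : banach A) v].

(* The 1-form of the reductive connection: the horizontal vector at h that the
   differential of the orbit map sends to v. *)
Definition kappa h v : 'M[A]_2 :=
  xget 0 [set X | horizontal h X /\ orbit_differential h X v].

Definition commutator X Y : 'M[A]_2 := X * Y - Y * X.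

(* D is the covariant derivative at t = 0 of the vector field zeta along the
   curve h, for the reductive connection. *)
Definition is_covariant_derivative (h : R -> A) (zeta : A -> A) (D : A) : Prop :=
  exists K : 'M[A]_2,
    mx_is_derive (fun t => kappa (h t) (zeta (h t))) 0 K /\
    kappa (h 0) D =
      K + commutator (kappa (h 0) (zeta (h 0)))
                     (kappa (h 0) (derive1 (h : R -> banach A) 0)).

End SiegelHalfSpace.

(* Main.v *)
Require Import Defs.
From mathcomp Require Import all_boot all_order all_algebra.
From mathcomp Require Import complex ring lra.
From mathcomp Require Import all_classical all_reals all_analysis.

Set Implicit Arguments.
Unset Strict Implicit.
Unset Printing Implicit Defensive.

Import Order.TTheory GRing.Theory Num.Theory.
Import numFieldNormedType.Exports.

Local Open Scope classical_set_scope.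
Local Open Scope ring_scope.

(* For h = x + iy every horizontal vector at h sends (1, h) into the line of
   (1, star h) and conversely, and it lies in the Lie algebra of U(theta_H).
   These conditions determine it from its velocity at h, and give
     kappa_h(v) = t_x M_y(v) t_(-x),   t_x = [[1, 0], [x, 1]],
     M_y(v) = 1/2 [[- y^-1 Im v, y^-1 (Re v) y^-1], [Re v, (Im v) y^-1]].
   Conversely a horizontal vector with prescribed velocity exists because
   y = star d * d with d invertible, so that [[d^-1, 0], [x d^-1, star d]] is an
   isometry sending i to h.  The covariant derivative is then obtained by
   differentiating this expression for kappa with the product rule; since
   kappa_h is injective, it is enough to check the formula after applying
   kappa_h. *)

(** [kappa] is a choice from a set described through an unspecified isometry [b], so it cannot be
    differentiated before it has a formula. The exchange of the lines of (1, h) and (1, star h)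
    mentions [h] alone: it makes [b] disappear, and independence of [b] comes with it. Positivity of
    y is a condition on the spectrum, so its factorization has to be built: square roots near 1 come
    from a fixed point, and are propagated along a segment. Differentiating the conjugate by t_x
    adds the commutator of E = [[0, 0], [x', 0]] with M = M_y(zeta); the connection adds that of M
    with N = M_y(h'). In the lower left entry, which holds half the real part of the result, the
    first gives - Re(x' y^-1 Upsilon) and the second gives half of Re(x' y^-1 Upsilon) - Re(y' y^-1
    chi): every word occurs along with its reverse, which is where the real parts in the formula
    come from. *)

Section NoncommutativeRing.

(** * Identities in noncommutative algebras, decided by reflection *)

Variables (K : comNzRingType) (A : algType K).

Inductive nc_expr :=
  | NCvar of nat | NC0 | NC1
  | NCadd of nc_expr & nc_expr | NCopp of nc_expr
  | NCmul of nc_expr & nc_expr | NCscale of K & nc_expr.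

(* The list and nat operations below are redefined so that [cbv] can unfold
   exactly these names and leave the coefficients in K untouched. *)
Definition nc_poly : Type := list (K * list nat).

Fixpoint nc_get (env : list A) (n : nat) : A :=
  match env, n with
  | nil, _ => 0
  | cons a _, O => a
  | cons _ env', S n' => nc_get env' n'
  end.

Fixpoint nc_eval (env : list A) (e : nc_expr) : A :=
  match e with
  | NCvar n => nc_get env n
  | NC0 => 0
  | NC1 => 1
  | NCadd a b => nc_eval env a + nc_eval env b
  | NCopp a => - nc_eval env a
  | NCmul a b => nc_eval env a * nc_eval env b
  | NCscale z a => z *: nc_eval env a
  end.

Fixpoint nc_app (T : Type) (s t : list T) : list T :=
  match s with nil => t | cons x s' => cons x (nc_app s' t) end.

(** Left multiplication by the term z m, the inner loop of [nc_mul]; with the empty monomial it is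
    scaling by z. *)
Fixpoint nc_scale (z : K) (m : list nat) (p : nc_poly) : nc_poly :=
  match p with
  | nil => nil
  | cons (c, m') p' => cons (z * c, nc_app m m') (nc_scale z m p')
  end.

Fixpoint nc_mul (p q : nc_poly) : nc_poly :=
  match p with
  | nil => nil
  | cons (c, m) p' => nc_app (nc_scale c m q) (nc_mul p' q)
  end.

Fixpoint nc_norm (e : nc_expr) : nc_poly :=
  match e with
  | NCvar n => cons (1, cons n nil) nil
  | NC0 => nil
  | NC1 => cons (1, nil) nil
  | NCadd a b => nc_app (nc_norm a) (nc_norm b)
  | NCopp a => nc_scale (-1) nil (nc_norm a)
  | NCmul a b => nc_mul (nc_norm a) (nc_norm b)
  | NCscale z a => nc_scale z nil (nc_norm a)
  end.

Fixpoint nc_eqn (m n : nat) : bool :=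
  match m, n with
  | O, O => true | S m', S n' => nc_eqn m' n' | _, _ => false
  end.

Fixpoint nc_eqm (s t : list nat) : bool :=
  match s, t with
  | nil, nil => true
  | cons m s', cons n t' => if nc_eqn m n then nc_eqm s' t' else false
  | _, _ => false
  end.

Fixpoint nc_insert (c : K) (m : list nat) (p : nc_poly) : nc_poly :=
  match p with
  | nil => cons (c, m) nil
  | cons (c', m') p' =>
      if nc_eqm m m' then cons (c + c', m') p'
      else cons (c', m') (nc_insert c m p')
  end.

Fixpoint nc_collect (p : nc_poly) : nc_poly :=
  match p with
  | nil => nil
  | cons (c, m) p' => nc_insert c m (nc_collect p')
  end.

(** The vanishing of coefficients is stated, not tested: each conjunct is left as an equation in K
    for [field]. *)
Fixpoint nc_zero (p : nc_poly) : Prop :=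
  match p with
  | nil => True
  | cons (c, _) p' => c = 0 /\ nc_zero p'
  end.

Fixpoint nc_monom (env : list A) (m : list nat) : A :=
  match m with nil => 1 | cons n m' => nc_get env n * nc_monom env m' end.

Fixpoint nc_peval (env : list A) (p : nc_poly) : A :=
  match p with
  | nil => 0
  | cons (c, m) p' => c *: nc_monom env m + nc_peval env p'
  end.

Lemma nc_eqm_eq s t : nc_eqm s t -> s = t.
Proof.
have eqn m n : nc_eqn m n -> m = n.
  by elim: m n => [|m IH] [|n] //= /IH ->.
by elim: s t => [|m s IH] [|n t] //=; case: ifP => // /eqn -> /IH ->.
Qed.

Lemma nc_peval_app env p q :
  nc_peval env (nc_app p q) = nc_peval env p + nc_peval env q.
Proof. by elim: p => [|[c m] p IH] /=; rewrite ?add0r // IH addrA. Qed.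

Lemma nc_monom_app env s t :
  nc_monom env (nc_app s t) = nc_monom env s * nc_monom env t.
Proof. by elim: s => [|n s IH] /=; rewrite ?mul1r // IH mulrA. Qed.

Lemma nc_peval_scale env z m p :
  nc_peval env (nc_scale z m p) = z *: (nc_monom env m * nc_peval env p).
Proof.
elim: p => [|[c m'] p IH] /=; first by rewrite mulr0 scaler0.
by rewrite IH nc_monom_app mulrDr scalerDr -scalerAr scalerA.
Qed.

Lemma nc_peval_mul env p q :
  nc_peval env (nc_mul p q) = nc_peval env p * nc_peval env q.
Proof.
elim: p => [|[c m] p IH] /=; first by rewrite mul0r.
by rewrite nc_peval_app nc_peval_scale IH mulrDl scalerAl.
Qed.

Lemma nc_normP env e : nc_peval env (nc_norm e) = nc_eval env e.
Proof.
elim: e => /= [n|||a <- b <-|a <-|a <- b <-|z a <-] //=.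
- by rewrite mulr1 scale1r addr0.
- by rewrite scale1r addr0.
- exact: nc_peval_app.
- by rewrite nc_peval_scale mul1r scaleN1r.
- exact: nc_peval_mul.
- by rewrite nc_peval_scale mul1r.
Qed.

Lemma nc_collectP env p : nc_peval env (nc_collect p) = nc_peval env p.
Proof.
have ins c m q : nc_peval env (nc_insert c m q)
    = c *: nc_monom env m + nc_peval env q.
  elim: q => [|[c' m'] q IH] //=; case: ifP => [/nc_eqm_eq ->|_] /=.
    by rewrite scalerDl addrA.
  by rewrite IH addrCA.
by elim: p => [|[c m] p IH] //=; rewrite ins IH.
Qed.

Lemma nc_correct env a b :
  nc_zero (nc_collect (nc_norm (NCadd a (NCopp b)))) ->
  nc_eval env a = nc_eval env b.
Proof.
move=> z; apply/eqP; rewrite -subr_eq0; apply/eqP.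
rewrite -[LHS]/(nc_eval env (NCadd a (NCopp b))) -nc_normP -nc_collectP.
by elim: (nc_collect _) z => [|[c m] p IH] //= [-> /IH ->]; rewrite scale0r addr0.
Qed.

End NoncommutativeRing.

Ltac nc_lookup a env :=
  match env with
  | cons a _ => constr:(O)
  | cons _ ?env' => let n := nc_lookup a env' in constr:(S n)
  end.

Ltac nc_vars e env :=
  match e with
  | @Algebra.add _ ?a ?b => let env := nc_vars a env in nc_vars b env
  | @GRing.mul _ ?a ?b => let env := nc_vars a env in nc_vars b env
  | @Algebra.opp _ ?a => nc_vars a env
  | @GRing.scale _ _ ?z ?a => nc_vars a env
  | @GRing.one _ => env
  | @Algebra.zero _ => env
  | _ => match env with
         | context [cons e _] => env
         | _ => constr:(cons e env)
         end
  end.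

Ltac nc_reify K e env :=
  match e with
  | @Algebra.add _ ?a ?b =>
      let a := nc_reify K a env in let b := nc_reify K b env in
      constr:(@NCadd K a b)
  | @GRing.mul _ ?a ?b =>
      let a := nc_reify K a env in let b := nc_reify K b env in
      constr:(@NCmul K a b)
  | @Algebra.opp _ ?a => let a := nc_reify K a env in constr:(@NCopp K a)
  | @GRing.scale _ _ ?z ?a =>
      let a := nc_reify K a env in constr:(@NCscale K z a)
  | @GRing.one _ => constr:(@NC1 K)
  | @Algebra.zero _ => constr:(@NC0 K)
  | _ => let n := nc_lookup e env in constr:(@NCvar K n)
  end.

(* Reduces an equation in the K-algebra A to the vanishing of the coefficients
   of the noncommutative monomials. *)
Ltac nc_coefs K A :=
  match goal with
  | |- ?a = ?b =>
      let env := nc_vars a (@nil A) in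
      let env := nc_vars b env in
      let ra := nc_reify K a env in
      let rb := nc_reify K b env in
      apply: (@nc_correct K A env ra rb);
      cbv [nc_zero nc_collect nc_insert nc_eqm nc_eqn nc_norm nc_mul nc_scale
           nc_app]
  end.

Lemma mulii (R : realType) : 'i * 'i = -1 :> R[i].
Proof. by rewrite -expr2 sqrCi. Qed.

(** To [field] the element 'i is an atom, so the relation 'i * 'i = -1 is handed to it as a
    hypothesis. *)
Ltac nc_ring R A :=
  nc_coefs (R[i] : comNzRingType) (A : algType R[i]);
  let H := fresh in
  pose proof (mulii R) as H;
  repeat split; rewrite ?invfM; by field : H.

Section BanachAlgebra.

(** * Inverses, square roots near 1 and factorization of positive elements *)

Variables (R : realType) (A : cstarAlgType R).
Implicit Types (a b e w : A) (r t : R).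
Local Notation V := (banach A).
Local Notation N := (@cstar_norm R A).

Lemma cstar_norm_ge0 a : 0 <= N a.
Proof. exact: (normr_ge0 (a : V)). Qed.

Lemma cstar_norm0 : N 0 = 0.
Proof. exact: (normr0 V). Qed.

Lemma cstar_normN a : N (- a) = N a.
Proof. exact: (normrN (a : V)). Qed.

Lemma cstar_normB a b : N (a - b) <= N a + N b.
Proof. exact: (ler_normB (a : V) (b : V)). Qed.

Lemma cstar_distC a b : N (a - b) = N (b - a).
Proof. exact: (distrC (a : V) (b : V)). Qed.

Lemma star0 : star 0 = 0 :> A.
Proof. by apply: (addrI (star 0)); rewrite -starD !addr0. Qed.

Lemma starN a : star (- a) = - star a.
Proof. by apply: (addrI (star a)); rewrite -starD !subrr star0. Qed.

Lemma starB a b : star (a - b) = star a - star b.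
Proof. by rewrite starD starN. Qed.

Lemma star1 : star 1 = 1 :> A.
Proof. by rewrite -[LHS]mulr1 -{2}(starK 1) -starM mulr1 starK. Qed.

Lemma star_unit a : a \is a GRing.unit -> star a \is a GRing.unit.
Proof.
by move=> ua; apply/unitrP; exists (star a^-1);
  rewrite -!starM divrr // mulVr // star1.
Qed.

Lemma starV a : a \is a GRing.unit -> star a^-1 = (star a)^-1.
Proof.
move=> ua; apply: (mulrI (star_unit ua)).
by rewrite -starM mulVr // star1 divrr // star_unit.
Qed.

(** The C*-identity bounds the square of [N b] by [N (star b) * N b]; cancelling [N b] gives one
    inequality, and the involution gives the other. *)
Lemma cstar_norm_star a : N (star a) = N a.
Proof.
have le b : N b <= N (star b).
  have [->|b0] := eqVneq b 0; first by rewrite star0.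
  have Nb : 0 < N b.
    rewrite lt_neqAle cstar_norm_ge0 andbT eq_sym.
    by apply/eqP => /cstar_norm0_eq0 /eqP; apply/negP.
  by rewrite -(ler_pM2r Nb) -expr2 -cstar_identity cstar_normM.
by apply/eqP; rewrite eq_le le andbT -{2}(starK a) le.
Qed.

Lemma geometric_steps_cvg (u : nat -> A) (c : R) :
  (forall n, N (u n.+1 - u n) <= c * 2^-1 ^+ n) ->
  exists l, forall e : R, 0 < e ->
    exists M : nat, forall n, (M <= n)%N -> N (u n - l) < e.
Proof.
move=> uc; apply: cstar_complete => e e0.
have c0 : 0 <= c.
  by have := uc 0%N; rewrite expr0 mulr1; exact: le_trans (cstar_norm_ge0 _).
(* The exact partial sum of the geometric series, for which the induction step is an equality. *)
have dist n k : N (u (n + k)%N - u n) <= 2 * c * (2^-1 ^+ n - 2^-1 ^+ (n + k)).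
  elim: k => [|k IH]; first by rewrite addn0 !subrr cstar_norm0 mulr0.
  rewrite addnS -[u _ - _](subrKA (u (n + k)%N)).
  apply: le_trans (cstar_normD _ _) _.
  apply: le_trans (lerD (uc _) IH) _.
  rewrite exprS le_eqVlt; apply/orP; left; by apply/eqP; field.
have cvg0 : (fun n => 2 * c * (2^-1 : R) ^+ n) @ \oo --> (0 : R).
  rewrite -[X in _ --> X](mulr0 (2 * c)); apply: cvgM; first exact: cvg_cst.
  by apply: cvg_expr; rewrite ger0_norm ?invf_lt1 ?ltr1n ?invr_ge0.
have e2 : 0 < e / 2 by rewrite divr_gt0.
have /cvgr0Pnorm_lt/(_ _ e2)[M _ HM] := cvg0.
have close n : (M <= n)%N -> N (u n - u M) < e / 2.
  move=> Mn; rewrite -(subnKC Mn).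
  apply: le_lt_trans (dist _ _) _; rewrite mulrBr.
  apply: le_lt_trans (HM M _) => //=.
  rewrite [X in _ <= X]ger0_norm ?gerBl ?mulr_ge0 ?exprn_ge0 ?invr_ge0 //.
exists M => m n Mm Mn; rewrite -[u m - u n](subrKA (u M)).
apply: le_lt_trans (cstar_normD _ _) _; rewrite [e]splitr.
by apply: ltrD; rewrite ?close // cstar_distC close.
Qed.

(** The iterates of [phi] from 0 take geometric steps inside the ball. Existence yields the inverses
    of [unit_near1]; uniqueness is what makes the square root of [sqrt_near1] selfadjoint. *)
Lemma contraction_fixpoint (phi : A -> A) (r : R) : 0 <= r ->
  (forall a, N a <= r -> N (phi a) <= r) ->
  (forall a b, N a <= r -> N b <= r ->
     N (phi a - phi b) <= 2^-1 * N (a - b)) ->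
  exists w, [/\ N w <= r, phi w = w &
    forall a, N a <= r -> phi a = a -> a = w].
Proof.
move=> r0 ball ctr; pose u n := iter n phi 0.
have ur n : N (u n) <= r by elim: n => [|n IH]; rewrite ?cstar_norm0 // ball.
have [|l ul] := @geometric_steps_cvg u r.
  elim=> [|n IH]; first by rewrite expr0 mulr1 subr0 ur.
  change (N (phi (u n.+1) - phi (u n)) <= r * 2^-1 ^+ n.+1).
  apply: le_trans (ctr _ _ (ur _) (ur _)) _.
  by rewrite exprS mulrCA ler_wpM2l ?invr_ge0.
have lr : N l <= r.
  apply/ler_addgt0Pr => e e0; have [M /(_ _ (leqnn M)) uM] := ul e e0.
  rewrite -[l](subrK (u M)) addrC; apply: le_trans (cstar_normD _ _) _.
  by rewrite lerD // cstar_distC ltW.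
have le_half (x : R) : 0 <= x -> x <= 2^-1 * x -> x = 0.
  by move=> x0 xh; apply/eqP; rewrite eq_le x0 andbT; lra.
have fl : phi l = l.
  apply/subr0_eq/cstar_norm0_eq0/eqP; rewrite eq_le cstar_norm_ge0 andbT.
  apply/ler_addgt0Pr => e e0; rewrite add0r.
  have e2 : 0 < e / 2 by rewrite divr_gt0.
  have [M uM] := ul _ e2.
  rewrite -(subrKA (u M.+1)) [e]splitr.
  apply: le_trans (cstar_normD _ _) _; apply: lerD; last exact/ltW/uM.
  have := ctr _ _ lr (ur M); rewrite (cstar_distC l).
  have := uM _ (leqnn M); have := cstar_norm_ge0 (u M - l); lra.
exists l; split=> // a ar fa.
apply/subr0_eq/cstar_norm0_eq0/le_half; first exact: cstar_norm_ge0.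
by have := ctr _ _ ar lr; rewrite fa fl.
Qed.

Lemma cstar_normZr (r : R) a : N (real_complex R r *: a) = `|r| * N a.
Proof. exact: real_normZ. Qed.

Lemma starZr (r : R) a : star (real_complex R r *: a) = real_complex R r *: star a.
Proof. by rewrite starZ; congr (_ *: _); rewrite /= /Num.conj /= oppr0. Qed.

Lemma cstar_normM_le a b (r s : R) : N a <= r -> N b <= s -> N (a * b) <= r * s.
Proof.
by move=> ar bs; apply: le_trans (cstar_normM _ _) _; apply: ler_pM;
  rewrite ?cstar_norm_ge0.
Qed.

(** The equation (1 + e)(1 + r) = 1 reads r = - e - e r, a contraction by 1/2 of the unit ball. The
    mirror equation gives a left inverse, and the two inverses agree. *)
Lemma unit_near1 e : N e <= 2^-1 -> 1 + e \is a GRing.unit.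
Proof.
move=> e2.
have ball (b : A) : N b <= 2^-1 -> N (- e - b) <= 1.
  move=> b2; apply: le_trans (cstar_normB _ _) _; rewrite cstar_normN; lra.
have [r [_ fr _]] : exists w, [/\ N w <= 1, - e - e * w = w &
    forall a, N a <= 1 -> - e - e * a = a -> a = w].
  apply: contraction_fixpoint => // [a a1|a b _ _].
    by apply: ball; rewrite -[_^-1]mulr1 cstar_normM_le.
  have -> : - e - e * a - (- e - e * b) = e * (b - a) by nc_ring R A.
  by rewrite (cstar_distC a); apply: le_trans (cstar_normM _ _) _;
    rewrite ler_wpM2r ?cstar_norm_ge0.
have [l [_ fl _]] : exists w, [/\ N w <= 1, - e - w * e = w &
    forall a, N a <= 1 -> - e - a * e = a -> a = w].
  apply: contraction_fixpoint => // [a a1|a b _ _].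
    by apply: ball; rewrite -[_^-1]mul1r cstar_normM_le.
  have -> : - e - a * e - (- e - b * e) = (b - a) * e by nc_ring R A.
  by rewrite (cstar_distC a) mulrC; apply: le_trans (cstar_normM _ _) _;
    rewrite ler_wpM2l ?cstar_norm_ge0.
have er : (1 + e) * (1 + r) = 1.
  have -> : (1 + e) * (1 + r) = 1 + r - (- e - e * r) by nc_ring R A.
  by rewrite fr addrK.
have le : (1 + l) * (1 + e) = 1.
  have -> : (1 + l) * (1 + e) = 1 + l - (- e - l * e) by nc_ring R A.
  by rewrite fl addrK.
have lr : 1 + l = 1 + r by rewrite -[LHS]mulr1 -[X in _ * X]er mulrA le mul1r.
by apply/unitrP; exists (1 + r); rewrite -{1}lr.
Qed.

Lemma unit_near a b : a \is a GRing.unit -> N (b - a) * N a^-1 <= 2^-1 ->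
  b \is a GRing.unit.
Proof.
move=> ua ba; have -> : b = a * (1 + a^-1 * (b - a)).
  by rewrite mulrDr mulrA divrr // mul1r mulr1 addrC subrK.
rewrite unitrMr // unit_near1 //.
by apply: le_trans (cstar_normM _ _) _; rewrite mulrC.
Qed.

Lemma inv_sub a b : a \is a GRing.unit -> b \is a GRing.unit ->
  b^-1 - a^-1 = - (b^-1 * (b - a) * a^-1).
Proof.
move=> ua ub; rewrite mulrBr mulVr // mulrBl mul1r -mulrA divrr // mulr1.
by rewrite opprB.
Qed.

(** By [inv_sub] the two inverses differ by at most half of [N b^-1], which is then absorbed on the
    left. *)
Lemma inv_near_le a b : a \is a GRing.unit -> N (b - a) * N a^-1 <= 2^-1 ->
  N b^-1 <= 2 * N a^-1.
Proof.
move=> ua ba; have ub := unit_near ua ba.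
have : N (b^-1 - a^-1) <= N b^-1 * 2^-1.
  rewrite inv_sub // cstar_normN -mulrA; apply: cstar_normM_le => //.
  exact: le_trans (cstar_normM _ _) ba.
have := cstar_normD (b^-1 - a^-1) a^-1; rewrite subrK.
set nb := N b^-1; set na := N a^-1; set nd := N _; lra.
Qed.

(** A square root 1 + w of 1 + e corresponds to a fixed point w of (e - w w) / 2, which maps the
    ball of radius 1/4 to itself. Since [star w] solves the same equation, uniqueness gives star w =
    w. *)
Lemma sqrt_near1 e : selfadjoint e -> N e <= 4^-1 ->
  exists c, [/\ c \is a GRing.unit, selfadjoint c & c * c = 1 + e].
Proof.
move=> es e4; pose phi w : A := real_complex R 2^-1 *: (e - w * w).
have [|||w [w4 fw uw]] := @contraction_fixpoint phi 4^-1; first by lra.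
- move=> a a4; rewrite cstar_normZr ger0_norm //.
  have := cstar_normB e (a * a); have := cstar_normM_le a4 a4.
  set x := N (a * a); set y := N (_ - _); lra.
- move=> a b a4 b4; rewrite -scalerBr cstar_normZr ger0_norm //.
  rewrite ler_wpM2l //.
  have -> : e - a * a - (e - b * b) = a * (b - a) + (b - a) * b.
    by nc_ring R A.
  rewrite (cstar_distC a); apply: le_trans (cstar_normD _ _) _.
  have := cstar_normM_le a4 (lexx (N (b - a))).
  have := cstar_normM_le (lexx (N (b - a))) b4.
  have := cstar_norm_ge0 (b - a).
  by set x := N (_ * _); set y := N (_ * _); set z := N _; lra.
have sw : selfadjoint w.
  apply: uw; first by rewrite cstar_norm_star.
  by have := congr1 (@star R A) fw; rewrite starZr starB starM es.
exists (1 + w); split.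
- by apply: unit_near1; lra.
- by rewrite /selfadjoint starD star1 sw.
have e2 : e - w * w = 2%:R *: w.
  rewrite -[in RHS]fw scalerA -(rmorph_nat (real_complex R)) -rmorphM.
  by rewrite divff // rmorph1 scale1r.
have -> : 1 + e = 1 + (e - w * w) + w * w by nc_ring R A.
by rewrite e2; nc_ring R A.
Qed.

(** The factor is not asked to be selfadjoint: [factorizable_near] multiplies it by a selfadjoint
    square root, and such products need not be selfadjoint. *)
Definition factorizable a := exists2 d, d \is a GRing.unit & star d * d = a.

(** Write b = star d (1 + e) d and take the square root of 1 + e. The C*-identity makes [N a^-1] the
    square of [N d^-1], so the admissible distance depends on [a] and not on the factor [d] reached
    so far. *)
Lemma factorizable_near a b : selfadjoint b -> factorizable a ->
  N (b - a) * N a^-1 <= 4^-1 -> factorizable b.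
Proof.
move=> sb [d ud da] ba; have us := star_unit ud.
have sa : selfadjoint a by rewrite -da /selfadjoint starM starK.
have [||r [ur sr rr]] := @sqrt_near1 (star d^-1 * (b - a) * d^-1).
- by rewrite /selfadjoint !starM starB starK sa sb mulrA.
- have Na : N a^-1 = N d^-1 * N d^-1.
    rewrite -da invrM // -starV //.
    by rewrite -{1}(starK d^-1) cstar_identity cstar_norm_star expr2.
  apply: le_trans ba; rewrite Na mulrA; apply: cstar_normM_le => //.
  by rewrite mulrC; apply: cstar_normM_le => //; rewrite cstar_norm_star.
exists (r * d); first by rewrite unitrMr.
rewrite starM sr -mulrA (mulrA r) rr mulrDl mul1r mulrDr da.
by rewrite -!mulrA mulVr // mulr1 starV // mulVKr // addrC subrK.
Qed.

(* [y] is joined to [1] by the segment [1 + t (y - 1)], which consists of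
   invertible elements; by compactness finitely many applications of
   [factorizable_near] lead from [1] to [y]. *)
Lemma positive_factorizable y : positive y -> y \is a GRing.unit ->
  factorizable y.
Proof.
move=> [sy py] uy; pose p t : A := 1 + real_complex R t *: (y - 1).
have p1 : p 1 = y by rewrite /p rmorph1 scale1r addrC subrK.
have p0 : p 0 = 1 by rewrite /p rmorph0 scale0r addr0.
have sp t : selfadjoint (p t).
  by rewrite /selfadjoint starD starZr starB star1 sy.
have dp t t' : N (p t - p t') = `|t - t'| * N (y - 1).
  by rewrite -cstar_normZr rmorphB scalerBl /p opprD addrACA subrr add0r.
have up t : 0 <= t <= 1 -> p t \is a GRing.unit.
  move=> /andP[t0 t1].
  have [->|tn0] := eqVneq t 0; first by rewrite p0 unitr1.
  have [->|tn1] := eqVneq t 1; first by rewrite p1.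
  have {}t0 : 0 < t by rewrite lt_neqAle eq_sym tn0.
  have {}t1 : t < 1 by rewrite lt_neqAle tn1.
  (* For 0 < t < 1 the number 1 - 1/t is negative, hence outside the spectrum of y. *)
  have -> : p t = real_complex R t *: (y - (real_complex R (1 - t^-1))%:A).
    rewrite /p !scalerBr scalerA -rmorphM mulrBr mulr1 divff // rmorphB rmorph1.
    by nc_ring R A.
  rewrite scaler_unit; last by rewrite unitfE fmorph_eq0.
  apply: contraT => /py; rewrite lecR subr_ge0 leNgt.
  by rewrite invf_gt1 ?t1.
pose S : set R := [set t | 0 <= t <= 1 /\ factorizable (p t)].
have S0 : S 0.
  split; first by rewrite lexx ler01.
  by rewrite p0; exists 1; rewrite ?unitr1 // star1 mulr1.
have S1 : ubound S 1 by move=> t [/andP[]].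
have hS : has_sup S by split; [exists 0|exists 1].
pose s := sup S.
have s01 : 0 <= s <= 1.
  by rewrite (ub_le_sup _ S0) ?ge_sup //; [exists 0|exists 1].
have [s0 s1] := andP s01.
pose C := N (y - 1) * N (p s)^-1.
have C0 : 0 <= C by rewrite mulr_ge0 ?cstar_norm_ge0.
(* A parameter t of S within [dl] of the supremum s is joined to s' = min(1, s + dl). The jump has
   length at most 2 dl and [N (p t)^-1] is at most twice [N (p s)^-1], so [factorizable_near] sees
   at most 4 dl C <= 1/4. *)
pose dl := (16 * (C + 1))^-1.
have dl0 : 0 < dl by rewrite invr_gt0; lra.
have dlC : dl * C <= 16^-1.
  have : dl * (16 * (C + 1)) = 1 by rewrite mulVf // gt_eqF //; lra.
  by move: dl0; set x := dl; nra.
have [t [t01 ft] st] := sup_adherent dl0 hS.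
rewrite -/s in st.
have ts : t <= s by apply: ub_le_sup => //; exists 1.
pose s' := Num.min 1 (s + dl).
have s's : s' <= s + dl by rewrite ge_min lexx orbT.
have ss' : s <= s' by rewrite le_min; lra.
have s'1 : s' <= 1 by rewrite ge_min lexx.
have inv_t : N (p t)^-1 <= 2 * N (p s)^-1.
  apply: inv_near_le; first exact: up.
  rewrite dp -mulrA -/C; apply: (@le_trans _ _ (dl * C)); last by lra.
  by rewrite ler_wpM2r // ler_norml; apply/andP; split; lra.
have Ss' : S s'.
  split; first by apply/andP; split=> //; lra.
  apply: (factorizable_near (sp s') ft).
  apply: (@le_trans _ _ (`|s' - t| * N (y - 1) * (2 * N (p s)^-1))).
    by rewrite dp ler_wpM2l // mulr_ge0 // cstar_norm_ge0.
  apply: (@le_trans _ _ (2 * dl * (2 * C))); last by lra.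
  have -> : `|s' - t| * N (y - 1) * (2 * N (p s)^-1) = `|s' - t| * (2 * C).
    by rewrite /C; ring.
  rewrite ler_wpM2r //; first by lra.
  by rewrite ler_norml; apply/andP; split; lra.
(* As s' lies in S it cannot exceed s, which excludes s' = s + dl. *)
have [s'E|lt1] := eqVneq s' 1; first by case: Ss' => _; rewrite s'E p1.
have : s' <= s by apply: ub_le_sup => //; exists 1.
move: lt1; rewrite /s' minEle; case: ifP => [|_]; first by rewrite eqxx.
by move=> _; lra.
Qed.

End BanachAlgebra.

Section ComplexParts.

(** * Real and imaginary parts *)

Variables (R : realType) (A : cstarAlgType R).
Implicit Types (a b h v : A).

Lemma star_half a : star ((2%:R : R[i])^-1 *: a) = (2%:R : R[i])^-1 *: star a.
Proof. by rewrite starZ fmorphV rmorph_nat. Qed.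

Lemma star_i a : star ('i *: a) = - ('i : R[i]) *: star a.
Proof. by rewrite starZ conjCi. Qed.

Lemma cImE a : cIm a = (- (2%:R^-1 * 'i) : R[i]) *: (a - star a).
Proof. by rewrite /cIm invfM invCi mulrN. Qed.

Lemma selfadjoint_cRe a : selfadjoint (cRe a).
Proof. by rewrite /selfadjoint /cRe star_half starD starK addrC. Qed.

Lemma selfadjoint_cIm a : selfadjoint (cIm a).
Proof.
rewrite /selfadjoint cImE starZ starB starK.
rewrite rmorphN rmorphM fmorphV rmorph_nat /= conjCi.
by nc_ring R A.
Qed.

Lemma cRe_cIm a : a = cRe a + ('i : R[i]) *: cIm a.
Proof. by rewrite cImE /cRe; nc_ring R A. Qed.

Lemma cRe_sa a b : selfadjoint a -> selfadjoint b ->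
  cRe (a + ('i : R[i]) *: b) = a.
Proof.
by move=> sa sb; rewrite /cRe starD star_i sa sb; nc_ring R A.
Qed.

Lemma cIm_sa a b : selfadjoint a -> selfadjoint b ->
  cIm (a + ('i : R[i]) *: b) = b.
Proof.
by move=> sa sb; rewrite cImE starD star_i sa sb; nc_ring R A.
Qed.

End ComplexParts.

Section TwoByTwo.

(** * Two by two matrices, the isometries of theta_H and their Lie algebra *)

Variables (R : realType) (A : cstarAlgType R).
Implicit Types (a b c d h s v : A) (g X : 'M[A]_2) (p q : 'cV[A]_2).

Definition mx2 a b c d : 'M[A]_2 :=
  \matrix_(i, j) if i == 0 then if j == 0 then a else b
                 else if j == 0 then c else d.

Lemma ord2P (P : 'I_2 -> Prop) : P 0 -> P 1 -> forall i, P i.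
Proof.
move=> P0 P1 [[|[|//]] lti].
- by rewrite (_ : Ordinal lti = 0) //; apply: val_inj.
- by rewrite (_ : Ordinal lti = 1) //; apply: val_inj.
Qed.

Lemma mx2_eqP g g' : g 0 0 = g' 0 0 -> g 0 1 = g' 0 1 ->
  g 1 0 = g' 1 0 -> g 1 1 = g' 1 1 -> g = g'.
Proof. by move=> *; apply/matrixP; do 2!apply: ord2P. Qed.

Lemma mx2_eta g : g = mx2 (g 0 0) (g 0 1) (g 1 0) (g 1 1).
Proof. by apply: mx2_eqP; rewrite mxE. Qed.

Lemma mulmx2E (n : nat) (g : 'M[A]_2) (B : 'M[A]_(2, n)) i j :
  (g *m B) i j = g i 0 * B 0 j + g i 1 * B 1 j.
Proof.
rewrite mxE !big_ord_recl big_ord0 addr0.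
by congr (_ + g i _ * B _ j); apply: val_inj.
Qed.

Lemma mulr2E (g g' : 'M[A]_2) i j :
  (g * g') i j = g i 0 * g' 0 j + g i 1 * g' 1 j.
Proof. exact: mulmx2E. Qed.

Lemma mx2M a b c d a' b' c' d' : mx2 a b c d * mx2 a' b' c' d' =
  mx2 (a * a' + b * c') (a * b' + b * d') (c * a' + d * c') (c * b' + d * d').
Proof. by apply: mx2_eqP; rewrite mulr2E !mxE. Qed.

Lemma mx2D a b c d a' b' c' d' : mx2 a b c d + mx2 a' b' c' d' =
  mx2 (a + a') (b + b') (c + c') (d + d').
Proof. by apply: mx2_eqP; rewrite !mxE. Qed.

Lemma mx2N a b c d : - mx2 a b c d = mx2 (- a) (- b) (- c) (- d).
Proof. by apply: mx2_eqP; rewrite !mxE. Qed.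

Lemma mx2_1 : mx2 1 0 0 1 = 1.
Proof. by apply: mx2_eqP; rewrite !mxE. Qed.

Lemma mx2_inj a b c d a' b' c' d' : mx2 a b c d = mx2 a' b' c' d' ->
  [/\ a = a', b = b', c = c' & d = d'].
Proof.
by move=> /matrixP E; split;
  [have := E 0 0|have := E 0 1|have := E 1 0|have := E 1 1]; rewrite !mxE.
Qed.

Lemma J_mx2 : J A = mx2 0 1 (-1) 0.
Proof. by apply: mx2_eqP; rewrite !mxE. Qed.

Lemma X_sP X : X_s X -> exists a b,
  [/\ selfadjoint a, selfadjoint b & X = mx2 a b b (- a)].
Proof.
move=> [/matrixP sX]; rewrite {1 2}(mx2_eta X) J_mx2 !mx2M mx2N => /mx2_inj.
rewrite !(mul0r, mulr0, mulN1r, mulrN1, mulr1, mul1r, add0r, addr0, opprK).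
move=> [/oppr_inj E0 E1 _ _].
exists (X 0 0), (X 0 1); split.
- by have := sX 0 0; rewrite !mxE.
- by have := sX 0 1; rewrite !mxE -E0.
- by rewrite {1}(mx2_eta X) -E0 {3}E1 opprK.
Qed.

Lemma X_s_mx2 a b : selfadjoint a -> selfadjoint b -> X_s (mx2 a b b (- a)).
Proof.
move=> sa sb; split.
  by apply: mx2_eqP; rewrite !mxE //= starN sa.
rewrite J_mx2 !mx2M mx2N.
by rewrite !(mul0r, mulr0, mulN1r, mulrN1, mulr1, mul1r, add0r, addr0, opprK).
Qed.

Definition col2 a b : 'cV[A]_2 := \col_i if i == 0 then a else b.

Lemma theta_HE p q :
  theta_H p q = ('i : R[i])^-1 *: (star (p 0 0) * q 1 0 - star (p 1 0) * q 0 0).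
Proof. by []. Qed.

Lemma theta_H_inj p q p' q' : theta_H p q = theta_H p' q' ->
  star (p 0 0) * q 1 0 - star (p 1 0) * q 0 0 =
  star (p' 0 0) * q' 1 0 - star (p' 1 0) * q' 0 0.
Proof. by apply: scalerI; rewrite invr_eq0 neq0Ci. Qed.

(** Invariance is tested on the two basis vectors. Together the relations say that [mx2 (star d) (-
    star b) (- star c) (star a)] is a left inverse of the matrix. *)
Lemma U_theta_rel a b c d : U_theta (mx2 a b c d) ->
  [/\ star a * c = star c * a, star a * d - star c * b = 1,
      star d * a - star b * c = 1 & star b * d = star d * b].
Proof.
move=> [_ th].
have rel p q := theta_H_inj (th p q).
have := rel (col2 1 0) (col2 1 0); have := rel (col2 1 0) (col2 0 1).
have := rel (col2 0 1) (col2 0 1).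
rewrite !mulmx2E !mxE /= star1 star0.
rewrite !(mul0r, mulr0, mulr1, mul1r, add0r, addr0, subr0, oppr0).
move=> /subr0_eq E11 E01 /subr0_eq E00; split=> //.
by rewrite -star1 -E01 starB !starM !starK.
Qed.

Lemma U_theta_mul g g' : U_theta g -> U_theta g' -> U_theta (g * g').
Proof.
move=> [[g1 [gK Kg]] th] [[g1' [gK' Kg']] th']; split.
  exists (g1' * g1); split; first by rewrite mulrA -(mulrA g) gK' mulr1.
  by rewrite mulrA -(mulrA g1') Kg mulr1.
by move=> p q; rewrite -!mulmxA th th'.
Qed.

Lemma U_theta_lower s : selfadjoint s -> U_theta (mx2 1 0 s 1).
Proof.
move=> ss; split.
  by exists (mx2 1 0 (- s) 1); rewrite !mx2M -mx2_1; split;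
    congr mx2; nc_ring R A.
move=> p q; rewrite !theta_HE !mulmx2E !mxE /=; congr (_ *: _).
by rewrite !starD !starM ss star1 star0; nc_ring R A.
Qed.

Lemma U_theta_upper s : selfadjoint s -> U_theta (mx2 1 s 0 1).
Proof.
move=> ss; split.
  by exists (mx2 1 (- s) 0 1); rewrite !mx2M -mx2_1; split;
    congr mx2; nc_ring R A.
move=> p q; rewrite !theta_HE !mulmx2E !mxE /=; congr (_ *: _).
by rewrite !starD !starM ss star1 star0; nc_ring R A.
Qed.

Lemma U_theta_diag d : d \is a GRing.unit -> U_theta (mx2 d 0 0 (star d)^-1).
Proof.
move=> ud; have us := star_unit ud; split.
  by exists (mx2 d^-1 0 0 (star d)); rewrite !mx2M -mx2_1; split;
    rewrite !(mul0r, mulr0, add0r, addr0) ?mulVr ?divrr.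
move=> p q; rewrite !theta_HE !mulmx2E !mxE /=; congr (_ *: _).
rewrite !mul0r !addr0 !add0r !starM -starV // starK.
rewrite -!mulrA (mulrA (star d)) -starM mulVr // star1 mul1r.
by rewrite mulKr.
Qed.

(** The Lie algebra of U(theta_H): the derivative at 1 of invariance of the form. Stated on vectors,
    it is visibly stable under conjugation by isometries. *)
Definition lie_theta X := forall p q, theta_H (X *m p) q = - theta_H p (X *m q).

Lemma lie_theta_rel a b c d : lie_theta (mx2 a b c d) ->
  [/\ selfadjoint b, selfadjoint c & d = - star a].
Proof.
move=> th.
have {th}rel p q : star ((mx2 a b c d *m p) 0 0) * q 1 0 -
    star ((mx2 a b c d *m p) 1 0) * q 0 0 =
    - (star (p 0 0) * (mx2 a b c d *m q) 1 0 -
       star (p 1 0) * (mx2 a b c d *m q) 0 0).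
  have := th p q; rewrite !theta_HE -scalerN.
  by apply: scalerI; rewrite invr_eq0 neq0Ci.
have := rel (col2 1 0) (col2 1 0); have := rel (col2 1 0) (col2 0 1).
have := rel (col2 0 1) (col2 0 1).
rewrite !mulmx2E !mxE /= star1 star0.
rewrite !(mul0r, mulr0, mulr1, mul1r, add0r, addr0, subr0, sub0r, opprK, oppr0).
by move=> E11 E01 /oppr_inj E00; split=> //; rewrite E01 opprK.
Qed.

Lemma lie_theta_X_s Z : X_s Z -> lie_theta Z.
Proof.
move=> /X_sP [a [b [sa sb ->]]] p q.
rewrite !theta_HE -scalerN !mulmx2E !mxE /=; congr (_ *: _).
by rewrite !starD !starM starN sa sb; nc_ring R A.
Qed.

Lemma lie_theta_conj g g' Z : U_theta g -> g * g' = 1 -> lie_theta Z ->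
  lie_theta (g * Z * g').
Proof.
move=> [_ th] gK lZ p q.
rewrite -[in LHS](mul1mx q) -[in RHS](mul1mx p) -[1%:M]/(1 : 'M[A]_2) -gK.
by rewrite -!mulmxA !th lZ.
Qed.

End TwoByTwo.

Section Horizontal.

(** * Horizontal vectors: the exchange property and uniqueness *)

Variables (R : realType) (A : cstarAlgType R).
Implicit Types (a b c d h s v x y : A) (g X : 'M[A]_2) (p q : 'cV[A]_2).

(* An isometry [b] with [b . i = h] sends the line of (1, i) to that of (1, h)
   and the line of (1, -i) to that of (1, star h); elements of X_s exchange the
   lines of (1, i) and (1, -i). *)
Lemma horizontal_exchange h X : horizontal h X -> exists u u' : A,
  [/\ X 0 0 + X 0 1 * h = u, X 1 0 + X 1 1 * h = star h * u,
      X 0 0 + X 0 1 * star h = u' & X 1 0 + X 1 1 * star h = h * u'].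
Proof.
move=> [b [b' [Z [Ub [bK Kb] [ud hE] /X_sP [a [c [sa sc ->]]] XE]]]].
have XbE : X * b = b * mx2 a c c (- a).
  by rewrite XE -!mulrA Kb mulr1.
move: Ub bK Kb XbE ud hE; rewrite /moebius /moebius_denom.
rewrite (mx2_eta b) (mx2_eta X) !mxE /=.
move: (b 0 0) (b 0 1) (b 1 0) (b 1 1) => p q r s.
move: (X 0 0) (X 0 1) (X 1 0) (X 1 1) => k l m n.
move=> Ub bK Kb; have [E00 E01 E01' E11] := U_theta_rel Ub.
rewrite !mx2M => /mx2_inj [Xpr Xqs Xpr' Xqs'].
set den := _ + _; move=> ud hE.
(* (den, e) and (den', e') are the images under b of (1, i) and (1, -i). *)
pose e : A := r + s * 'i%:A; pose den' : A := p - q * 'i%:A.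
pose e' : A := r - s * 'i%:A.
have eE : e = h * den by rewrite -hE divrK.
(* theta_H vanishes on the pair (1, i), (1, -i), hence on its image under b: star den e' = star e
   den'. *)
have e'E : e' = star h * den'.
  apply: (mulrI (star_unit ud)); rewrite mulrA -starM -eE.
  rewrite /e /den /e' /den' !starD !starM !star_i star1.
  apply: subr0_eq.
  transitivity (star p * r - star r * p
     - 'i *: (star p * s - star r * q) + 'i *: (star s * p - star q * r)
     + (star s * q - star q * s)); first by nc_ring R A.
  by rewrite E00 E01 E01' E11; nc_ring R A.
(* The last claim needs den' to be cancelled on the right, while [horizontal] speaks of den only.
   The left inverse given by the relations must be b', and the upper right entry of b b' = 1 is this
   equation; it makes den' star den' equal to the invertible den star den. *)
have pq : p * star q = q * star p.
  have b'E : b' = mx2 (star s) (- star q) (- star r) (star p).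
    have E : mx2 (star s) (- star q) (- star r) (star p) * mx2 p q r s = 1.
      rewrite mx2M -mx2_1 !mulNr; congr mx2.
      - exact: E01'.
      - by rewrite E11 subrr.
      - by rewrite E00 addrC subrr.
      - by rewrite addrC.
    by rewrite -[RHS]mulr1 -bK mulrA E mul1r.
  have := bK; rewrite b'E mx2M -mx2_1 => /mx2_inj [_ E _ _].
  by apply: subr0_eq; rewrite -[RHS]oppr0 -E; nc_ring R A.
have den'V : den' * (star den' * (den * star den)^-1) = 1.
  have -> : den' * (star den' * (den * star den)^-1) =
     (den' * star den') * (den * star den)^-1 by rewrite mulrA.
  have -> : den' * star den' = den * star den.
    rewrite /den' /den !(starD, starN, starM, star_i, star1).
    apply: subr0_eq.
    transitivity ('i *: (2%:R *: (p * star q - q * star p)) : A).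
      by nc_ring R A.
    by rewrite pq subrr !scaler0.
  by rewrite divrr // unitrMr // star_unit.
exists (k + l * h), (k + l * star h); split=> //.
  apply: (mulIr ud).
  have -> : (m + n * h) * den = m * den + n * e by rewrite eE; nc_ring R A.
  have -> : star h * (k + l * h) * den = star h * (k * den + l * e).
    by rewrite eE; nc_ring R A.
  (* The element of X_s sends (1, i) to (1, -i)(a + ic), so X sends (den, e) to (den', e')(a +
     ic). *)
  have -> : m * den + n * e = e' * (a + 'i *: c).
    transitivity (m * p + n * r + 'i *: (m * q + n * s)).
      by rewrite /den /e; nc_ring R A.
    by rewrite Xpr' Xqs' /e'; nc_ring R A.
  have -> : k * den + l * e = den' * (a + 'i *: c).
    transitivity (k * p + l * r + 'i *: (k * q + l * s)).
      by rewrite /den /e; nc_ring R A.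
    by rewrite Xpr Xqs /den'; nc_ring R A.
  by rewrite e'E mulrA.
rewrite -[LHS]mulr1 -[RHS]mulr1 -den'V !mulrA; congr (_ * _ * _).
have -> : (m + n * star h) * den' = m * den' + n * e' by rewrite e'E; nc_ring R A.
have -> : h * (k + l * star h) * den' = h * (k * den' + l * e').
  by rewrite e'E; nc_ring R A.
have -> : m * den' + n * e' = e * (a - 'i *: c).
  transitivity (m * p + n * r - 'i *: (m * q + n * s)).
    by rewrite /den' /e'; nc_ring R A.
  by rewrite Xpr' Xqs' /e; nc_ring R A.
have -> : k * den' + l * e' = den * (a - 'i *: c).
  transitivity (k * p + l * r - 'i *: (k * q + l * s)).
    by rewrite /den' /e'; nc_ring R A.
  by rewrite Xpr Xqs /den; nc_ring R A.
by rewrite eE mulrA.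
Qed.

Lemma horizontal_lie h X : horizontal h X -> lie_theta X.
Proof.
move=> [b [b' [Z [Ub [bK _] _ /lie_theta_X_s lZ ->]]]].
exact: lie_theta_conj lZ.
Qed.

(** The velocity at [h] of the fractional linear action in the direction X, see
    [is_derive_moebius]. *)
Definition infinitesimal_action h X : A :=
  X 1 0 + X 1 1 * h - h * (X 0 0 + X 0 1 * h).

Definition translation x : 'M[A]_2 := mx2 1 0 x 1.

(* The 1-form at [i y]; the one at [x + i y] is its conjugate under the
   translation by x. *)
Definition kappa_mx y v1 v2 : 'M[A]_2 :=
  mx2 (- ((2%:R : R[i])^-1 *: (y^-1 * v2))) ((2%:R : R[i])^-1 *: (y^-1 * v1 * y^-1))
      ((2%:R : R[i])^-1 *: v1) ((2%:R : R[i])^-1 *: (v2 * y^-1)).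

(** The velocity is star h u - h u = - 2i y u, which determines u; its adjoint, rewritten with the
    Lie algebra relations, is 2i y u' and determines u'. Then u - u' = 2i l y gives the entry l, and
    the other entries follow. *)
Lemma horizontal_unique x y v1 v2 X :
  selfadjoint x -> selfadjoint y -> y \is a GRing.unit ->
  selfadjoint v1 -> selfadjoint v2 ->
  horizontal (x + ('i : R[i]) *: y) X ->
  infinitesimal_action (x + ('i : R[i]) *: y) X = v1 + ('i : R[i]) *: v2 ->
  X = translation x * kappa_mx y v1 v2 * translation (- x).
Proof.
move=> sx sy uy sv1 sv2 hX.
have [u [u' [E1 E2 E3 E4]]] := horizontal_exchange hX.
have lX := horizontal_lie hX.
rewrite /infinitesimal_action E1 E2.
rewrite (mx2_eta X) in lX *; have [sl sm nE] := lie_theta_rel lX.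
move: E1 E2 E3 E4 sl sm nE {lX hX}; rewrite starD star_i sx sy.
move: (X 0 0) (X 0 1) (X 1 0) (X 1 1) => k l m n.
move=> E1 E2 E3 E4 sl sm nE vE; rewrite !scaleNr in E2 E3 E4 vE.
have uE : u = (2%:R^-1 * 'i : R[i]) *: (y^-1 * (v1 + 'i *: v2)).
  rewrite -vE -[u in LHS](mulKr uy).
  by nc_ring R A.
have vE' : v1 - 'i *: v2 = (2%:R * 'i : R[i]) *: (y * u').
  have := congr1 (@star R A) vE; rewrite (starD v1) star_i sv1 sv2 !scaleNr => <-.
  rewrite -E2 -E1.
  rewrite !(starB, starD, starM, star_i) sx sy sl sm nE starN starK.
  transitivity ((m + n * (x - 'i *: y)) - (x - 'i *: y) * (k + l * (x - 'i *: y))).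
    by rewrite nE; nc_ring R A.
  by rewrite E3 E4; nc_ring R A.
have u'E : u' = (- (2%:R^-1 * 'i) : R[i]) *: (y^-1 * (v1 - 'i *: v2)).
  by rewrite vE' -[u' in LHS](mulKr uy); nc_ring R A.
have lE : l = (2%:R^-1 : R[i]) *: (y^-1 * v1 * y^-1).
  have E : (2%:R * 'i : R[i]) *: (l * y) = u - u' by rewrite -E1 -E3; nc_ring R A.
  rewrite -[LHS](mulrK uy).
  transitivity ((- (2%:R^-1 * 'i) : R[i]) *: (((2%:R * 'i) *: (l * y)) * y^-1)).
    by nc_ring R A.
  by rewrite E uE u'E; nc_ring R A.
have lyE : l * y = (2%:R^-1 : R[i]) *: (y^-1 * v1).
  by rewrite lE -scalerAl mulrVK.
have kE : k = - (2%:R^-1 *: (y^-1 * v2)) - l * x.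
  transitivity (u - l * x - 'i *: (l * y)); first by rewrite -E1; nc_ring R A.
  by rewrite lyE uE; nc_ring R A.
have syV : star y^-1 = y^-1 by rewrite starV // sy.
have nE' : n = 2%:R^-1 *: (v2 * y^-1) + x * l.
  rewrite nE kE !(starB, starN, starD, starM, star_half) syV sv2 sx sl.
  by nc_ring R A.
have mE : m = (2%:R^-1 : R[i]) *: v1 + x * k - n * x + x * l * x.
  transitivity ((x - 'i *: y) * u - n * (x + 'i *: y)).
    by rewrite -E2 addrK.
  transitivity (x * u - 'i *: (y * u) - n * x - 'i *: (n * y)).
    by nc_ring R A.
  have -> : n * y = 2%:R^-1 *: v2 + x * (l * y).
    by rewrite nE' mulrDl -scalerAl mulrVK // mulrA.
  have -> : y * u = (2%:R^-1 * 'i : R[i]) *: (v1 + 'i *: v2).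
    by rewrite uE -scalerAr mulVKr.
  by rewrite lyE uE kE; nc_ring R A.
rewrite /translation /kappa_mx !mx2M; congr mx2.
- by rewrite kE lE; nc_ring R A.
- by rewrite lE; nc_ring R A.
- by rewrite mE nE' kE lE; nc_ring R A.
- by rewrite nE' lE; nc_ring R A.
Qed.

End Horizontal.

Section HorizontalExistence.

(** * Horizontal vectors with prescribed velocity *)

Variables (R : realType) (A : cstarAlgType R).
Implicit Types (a b c d h s v x y : A).

Lemma horizontal_exists h v : siegel h ->
  exists2 X, horizontal h X & infinitesimal_action h X = v.
Proof.
move=> [py uy]; have [d ud dy] := positive_factorizable py uy.
have uD := star_unit ud.
pose x := cRe h; pose D := star d; pose e := d^-1; pose f := D^-1.
have hE : h = x + 'i *: (D * d) by rewrite /D dy -cRe_cIm.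
have fD : f * D = 1 by rewrite mulVr.
have Df : D * f = 1 by rewrite divrr.
have ed : e * d = 1 by rewrite mulVr.
have de : d * e = 1 by rewrite divrr.
have se : star e = f by rewrite starV.
have sf : star f = e by rewrite -se starK.
(* The matrix with entries a, c, c, -a has velocity 2c - 2ia at i, and b acts by z |-> x + D z d; so
   a and c solve D (2c - 2ia) d = v. *)
pose a := - (2%:R^-1 : R[i]) *: (f * cIm v * e).
pose c := (2%:R^-1 : R[i]) *: (f * cRe v * e).
have sa : selfadjoint a.
  by rewrite /selfadjoint /a scaleNr starN star_half !starM se sf
    selfadjoint_cIm mulrA.
have sc : selfadjoint c.
  by rewrite /selfadjoint /c star_half !starM se sf selfadjoint_cRe mulrA.
have DDa : D * a * d = - (2%:R^-1 : R[i]) *: cIm v.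
  transitivity (- (2%:R^-1 : R[i]) *: ((D * f) * cIm v * (e * d))).
    by rewrite /a; nc_ring R A.
  by rewrite Df ed mul1r mulr1.
have DDc : D * c * d = (2%:R^-1 : R[i]) *: cRe v.
  transitivity ((2%:R^-1 : R[i]) *: ((D * f) * cRe v * (e * d))).
    by rewrite /c; nc_ring R A.
  by rewrite Df ed mul1r mulr1.
pose b := mx2 e 0 (x * e) D; pose b' := mx2 d 0 (- (f * x)) f.
exists (b * mx2 a c c (- a) * b').
  exists b, b', (mx2 a c c (- a)); split=> //.
  - have -> : b = mx2 1 0 x 1 * mx2 e 0 0 (star e)^-1.
      by rewrite se invrK mx2M; congr mx2; nc_ring R A.
    apply: U_theta_mul; first exact/U_theta_lower/selfadjoint_cRe.
    by apply: U_theta_diag; rewrite unitrV.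
  - rewrite !mx2M -mx2_1; split; congr mx2; rewrite ?(mul0r, mulr0, addr0, add0r) //.
      by rewrite mulrN mulrA Df mul1r -mulrA ed mulr1 subrr.
    by rewrite mulNr mulrA addrC subrr.
  - rewrite /moebius /moebius_denom !mxE /= mul0r addr0 unitrV; split=> //.
    rewrite mulrDl invrK -mulrA ed mulr1 -scalerAr mulr1 -scalerAl.
    by rewrite -hE.
  - exact: X_s_mx2.
rewrite /infinitesimal_action !mx2M !mxE /=.
set k := e * a + _.
set l := e * c + _.
have lE : l = e * c by rewrite /l mul0r addr0.
have kE : k = e * a by rewrite /k mul0r addr0.
have fst : k * d + l * - (f * x) + (k * 0 + l * f) * h
    = e * a * d + 'i *: (e * c * d).
  (* [nc_ring] treats d, e, D, f as unrelated letters, so the products to be cancelled are kept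
     visible for a later rewrite. *)
  transitivity (e * a * d + 'i *: (e * c * (f * D) * d)).
    by rewrite hE lE kE; nc_ring R A.
  by rewrite fD mulr1.
rewrite fst.
transitivity (x * e * a * d + D * c * d + 'i *: (x * e * c * (f * D) * d)
   - 'i *: (D * a * (f * D) * d) - x * e * a * d - 'i *: (x * e * c * d)
   - 'i *: (D * (d * e) * a * d) + D * (d * e) * c * d).
  by rewrite hE; nc_ring R A.
rewrite fD de !mulr1 DDa DDc.
transitivity (cRe v + 'i *: cIm v); last by rewrite -cRe_cIm.
by nc_ring R A.
Qed.

End HorizontalExistence.

Section RealDerivatives.

(** * Derivatives of curves and the chain rule *)

Variables (R : realType) (E : normedModType R).
Implicit Types (f : R -> E) (t : R) (df : E).

Lemma is_derive_cvg f t df : is_derive t (1 : R) f df <->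
  h^-1 *: (f (h + t) - f t) @[h --> 0^'] --> df.
Proof.
have qE h : h^-1 *: ((f \o shift t) (h *: (1 : R)) - f t)
         = h^-1 *: (f (h + t) - f t).
  by rewrite /= /shift [h *: _]mulr1.
split=> [dfE|cf].
  have := @ex_derive _ _ _ _ _ _ _ dfE; rewrite /derivable.
  have <- := @derive_val _ _ _ _ _ _ _ dfE; rewrite /derive.
  by under eq_fun do rewrite qE.
apply: DeriveDef.
  by apply: cvgP; under eq_fun do rewrite qE; exact: cf.
by apply: cvg_lim; [exact: norm_hausdorff|under eq_fun do rewrite qE; exact: cf].
Qed.

Lemma is_derive_unique f t df df' :
  is_derive t (1 : R) f df -> is_derive t (1 : R) f df' -> df = df'.
Proof.
by move=> H1 H2; rewrite -(@derive_val _ _ _ _ _ _ _ H1)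
  (@derive_val _ _ _ _ _ _ _ H2).
Qed.

Lemma derive1_val f t df : is_derive t (1 : R) f df -> derive1 f t = df.
Proof. by move=> H; rewrite derive1E; exact: (@derive_val _ _ _ _ _ _ _ H). Qed.

Lemma is_derive_cvg0 f t df : is_derive t (1 : R) f df ->
  f (h + t) @[h --> 0^'] --> f t.
Proof.
move=> /is_derive_cvg cf; apply/subr_cvg0.
have : h *: (h^-1 *: (f (h + t) - f t)) @[h --> 0^'] --> (0 : R) *: df.
  apply: cvgZ cf; apply: cvg_trans (@cvg_id _ (nbhs (0 : R))).
  exact: nbhs_dnbhs.
rewrite scale0r; apply: cvg_trans; apply: near_eq_cvg.
near=> h.
have h0 : h != 0 by near: h; exact: nbhs_dnbhs_neq.
by rewrite scalerA divff // scale1r.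
Unshelve. all: by end_near. Qed.

Lemma is_derive_continuous f t df : is_derive t (1 : R) f df ->
  f s @[s --> t] --> f t.
Proof. by move=> /is_derive_cvg0 /continuous_withinNshiftx. Qed.

Lemma is_derive_scale t (a : E) : is_derive t (1 : R) (fun s : R => s *: a) a.
Proof.
apply/is_derive_cvg; apply: cvg_near_cst; near=> h.
have h0 : h != 0 by near: h; exact: nbhs_dnbhs_neq.
by rewrite -scalerBl addrK scalerA mulVf // scale1r.
Unshelve. all: by end_near. Qed.

End RealDerivatives.

(** The chain rule, with [D (c t) [:: _]] as differential of [f]. Taking the identity for [c], it
    also turns smoothness of a curve into differentiability. *)
Lemma smooth_on_comp_derive (R : realType) (V E : normedModType R) (W : set V)
    (f : V -> E) (c : R -> V) (t : R) (dc : V) :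
  smooth_on W f -> open W -> W (c t) -> is_derive t (1 : R) c dc ->
  exists df, is_derive t (1 : R) (f \o c) df.
Proof.
move=> [D sD] oW Wc dcE; have [Dx0 lin bnd rem] := sD _ Wc.
pose L v := D (c t) [:: v].
have [C bC] := bnd 1%N.
have {}bC v : `|L v| <= `|C| * `|v|.
  have := bC [:: v] erefl; rewrite big_seq1 => /le_trans; apply.
  by rewrite ler_wpM2r // ler_norm.
have linL (r : R) u v : L (r *: u + v) = r *: L u + L v := lin [::] [::] r u v.
have LB u v : L (u - v) = L u - L v.
  by rewrite addrC -scaleN1r linL scaleN1r addrC.
have L0 : L 0 = 0 by rewrite -(subrr 0) LB subrr.
have LZ (r : R) v : L (r *: v) = r *: L v.
  by rewrite -[r *: v]addr0 linL L0 addr0.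
have cv0 := is_derive_cvg0 dcE; have /subr_cvg0 cu := cv0.
have cq := (is_derive_cvg c t dc).1 dcE.
exists (L dc); apply/is_derive_cvg; apply/cvgrPdist_le => e e0 /=.
(* Half of e pays for the remainder of f, as the difference quotient of c is eventually bounded by
   M; the other half pays for the error of that quotient, magnified by L. The added 1 keeps the
   divisors positive. *)
pose M := `|dc| + 1.
have M0 : 0 < M by rewrite ltr_wpDl.
have eM : 0 < e / 2 / M by rewrite !divr_gt0.
have eC : 0 < e / 2 / (`|C| + 1) by rewrite !divr_gt0 // ltr_wpDl.
have Wnear : \forall u \near (0 : V), W (c t + u).
  have : nbhs (c t + 0) W by rewrite addr0; apply: open_nbhs_nbhs.
  by apply: (@continuousD _ _ _ (cst (c t)) id 0 (cvg_cst _) cvg_id).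
have Wh : \forall h \near 0^', W (c t + (c (h + t) - c t)) := cu _ Wnear.
have Rh : \forall h \near 0^', forall s, size s = 0%N ->
    `|D (c t + (c (h + t) - c t)) s - D (c t) s - D (c t) (c (h + t) - c t :: s)|
    <= e / 2 / M * `|c (h + t) - c t| * \prod_(v <- s) `|v| :=
  cu _ (rem 0%N _ eM).
near=> h.
have h0 : h != 0 by near: h; exact: nbhs_dnbhs_neq.
pose u := c (h + t) - c t.
have cuE : c (h + t) = c t + u by rewrite /u [RHS]addrC subrK.
have Wu : W (c t + u) by rewrite /u; near: h; exact: Wh.
have ru : `|f (c t + u) - f (c t) - L u| <= e / 2 / M * `|u|.
  have : forall s, size s = 0%N -> `|D (c t + u) s - D (c t) s - D (c t) (u :: s)|
      <= e / 2 / M * `|u| * \prod_(v <- s) `|v| by rewrite /u; near: h; exact: Rh.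
  move=> /(_ [::] erefl); rewrite big_nil mulr1 Dx0.
  by have [-> _ _ _] := sD _ Wu.
have qM : `|h^-1 *: u| <= M.
  by rewrite /u; near: h; apply: (cvgr_norm_le dc cq); rewrite ltrDl.
have qd : `|dc - h^-1 *: u| <= e / 2 / (`|C| + 1).
  by rewrite /u; near: h; move/cvgrPdist_le : cq; exact.
rewrite /= cuE.
have -> : L dc - h^-1 *: (f (c t + u) - f (c t)) =
    L (dc - h^-1 *: u) - h^-1 *: (f (c t + u) - f (c t) - L u).
  rewrite LB LZ [in RHS]scalerBr.
  by rewrite opprB [RHS]addrA subrK.
apply: le_trans (ler_normB _ _) _; rewrite [e]splitr; apply: lerD.
  apply: le_trans (bC _) _; apply: (@le_trans _ _ ((`|C| + 1) * (e / 2 / (`|C| + 1)))).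
    by apply: ler_pM => //; rewrite lerDl.
  by rewrite mulrC divfK // gt_eqF // ltr_wpDl.
rewrite normrZ; apply: (@le_trans _ _ (`|h^-1| * (e / 2 / M * `|u|))).
  by rewrite ler_wpM2l.
rewrite mulrCA -normrZ -[leRHS](@divfK _ M) ?gt_eqF //.
by rewrite ler_wpM2l // ltW.
Unshelve. all: by end_near. Qed.

Section BanachAlgebraDerivatives.

(** * Differentiation of products, inverses and adjoints in the algebra *)

Variables (R : realType) (A : cstarAlgType R).
Local Notation V := (banach A).
Local Notation N := (@cstar_norm R A).

Lemma cvg_cstarM (T : Type) (F : set_system T) {FF : Filter F}
    (f g : T -> V) (a b : V) : f @ F --> a -> g @ F --> b ->
  ((fun x => (f x : A) * g x) : T -> V) @ F --> ((a : A) * b : V).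
Proof.
move=> /subr_cvg0 fa /subr_cvg0 gb; apply/subr_cvg0/norm_cvg0P.
have nf : `|f x - a| @[x --> F] --> (0 : R) by exact/norm_cvg0P.
have ng : `|g x - b| @[x --> F] --> (0 : R) by exact/norm_cvg0P.
pose bound x : R := `|f x - a| * `|g x - b| + `|f x - a| * `|b| + `|a| * `|g x - b|.
apply: (@squeeze_cvgr _ _ _ _ (cst 0) bound).
- near=> x; rewrite normr_ge0 /=.
  have -> : (f x : A) * g x - (a : A) * b =
    ((f x - a : A) * (g x - b : A) + (f x - a : A) * b) + (a : A) * (g x - b : A).
    by nc_ring R A.
  apply: le_trans (cstar_normD _ _) _; apply: lerD; last exact: cstar_normM.
  apply: le_trans (cstar_normD _ _) _; apply: lerD; exact: cstar_normM.
- exact: cvg_cst.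
- rewrite /bound -[X in _ --> X](_ : 0 * 0 + 0 * `|b| + `|a| * 0 = 0 :> R);
    last by rewrite !mul0r mulr0 !addr0.
  by apply: cvgD; [apply: cvgD|]; apply: cvgM => //; exact: cvg_cst.
Unshelve. all: by end_near. Qed.

Lemma unit_near_cvg (T : Type) (F : set_system T) {FF : Filter F}
    (f : T -> V) (a : A) : a \is a GRing.unit -> f @ F --> (a : V) ->
  \forall x \near F, N ((f x : A) - a) * N a^-1 <= 2^-1.
Proof.
move=> ua fa.
have e0 : 0 < (2 * (N a^-1 + 1))^-1.
  by rewrite invr_gt0 mulr_gt0 // ltr_wpDl // cstar_norm_ge0.
move/cvgrPdist_le : fa => /(_ _ e0); apply: filterS => x.
rewrite distrC => H; apply: (@le_trans _ _ ((2 * (N a^-1 + 1))^-1 * (N a^-1 + 1))).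
  by apply: ler_pM; rewrite ?cstar_norm_ge0 ?lerDl.
rewrite invfM -mulrA mulVf ?mulr1 // gt_eqF //.
by rewrite ltr_wpDl // cstar_norm_ge0.
Qed.

Lemma cvg_cstarV (T : Type) (F : set_system T) {FF : Filter F}
    (f : T -> V) (a : A) : a \is a GRing.unit -> f @ F --> (a : V) ->
  ((fun x => (f x : A)^-1) : T -> V) @ F --> (a^-1 : V).
Proof.
move=> ua fa.
have nf : `|f x - a| @[x --> F] --> (0 : R) by exact/norm_cvg0P/subr_cvg0.
apply/subr_cvg0/norm_cvg0P.
pose bound x : R := 2 * N a^-1 * `|f x - a| * N a^-1.
apply: (@squeeze_cvgr _ _ _ _ (cst 0) bound).
- near=> x; rewrite normr_ge0 /=.
  have nx : N ((f x : A) - a) * N a^-1 <= 2^-1.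
    by near: x; exact: unit_near_cvg.
  have -> : (f x : A)^-1 - a^-1 = - ((f x : A)^-1 * ((f x : A) - a) * a^-1).
    by apply: inv_sub => //; exact: unit_near nx.
  rewrite [leLHS]cstar_normN; apply: cstar_normM_le => //.
  by apply: cstar_normM_le => //; exact: inv_near_le.
- exact: cvg_cst.
- rewrite /bound -[X in _ --> X](_ : 2 * N a^-1 * 0 * N a^-1 = 0 :> R);
    last by rewrite mulr0 mul0r.
  by apply: cvgM; [apply: cvgM => //|]; exact: cvg_cst.
Unshelve. all: by end_near. Qed.

Lemma banach_scaleE (r : R) (a : V) : r *: a = real_complex R r *: (a : A) :> A.
Proof. by []. Qed.

Lemma is_derive_cstarM (f g : R -> V) (t : R) (df dg : V) :
  is_derive t (1 : R) f df -> is_derive t (1 : R) g dg ->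
  is_derive t (1 : R) ((fun s => (f s : A) * g s) : R -> V)
    ((df : A) * g t + (f t : A) * dg).
Proof.
move=> dfE dgE; apply/is_derive_cvg.
have cg := is_derive_cvg0 dgE.
move: dfE dgE => /is_derive_cvg cf /is_derive_cvg cg'.
have : (((h^-1 *: (f (h + t) - f t) : V) : A) * g (h + t)
        + (f t : A) * (h^-1 *: (g (h + t) - g t) : V) : V) @[h --> 0^']
     --> ((df : A) * g t + (f t : A) * dg : V).
  by apply: cvgD; apply: cvg_cstarM => //; exact: cvg_cst.
apply: cvg_trans; apply: near_eq_cvg; near=> h.
rewrite !banach_scaleE -scalerAl -scalerAr -scalerDr; congr (_ *: _).
by nc_ring R A.
Unshelve. all: by end_near. Qed.

Lemma is_derive_cstarV (f : R -> V) (t : R) (df : V) :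
  (f t : A) \is a GRing.unit -> is_derive t (1 : R) f df ->
  is_derive t (1 : R) ((fun s => (f s : A)^-1) : R -> V)
    (- ((f t : A)^-1 * df * (f t : A)^-1)).
Proof.
move=> ut dfE; apply/is_derive_cvg.
have cf0 := is_derive_cvg0 dfE.
move: dfE => /is_derive_cvg cf.
have : (- (((f (h + t) : A)^-1 * (h^-1 *: (f (h + t) - f t) : V))
           * (f t : A)^-1) : V) @[h --> 0^']
     --> (- ((f t : A)^-1 * df * (f t : A)^-1) : V).
  apply: cvgN; apply: cvg_cstarM; last exact: cvg_cst.
  by apply: cvg_cstarM => //; apply: cvg_cstarV.
apply: cvg_trans; apply: near_eq_cvg; near=> h.
have uh : (f (h + t) : A) \is a GRing.unit.
  apply: (unit_near ut); near: h; exact: unit_near_cvg.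
rewrite !banach_scaleE inv_sub // -scalerAr -scalerAl scalerN; congr (- (_ *: _)).
Unshelve. all: by end_near. Qed.

(** Linearity is asked over the reals because [star] is conjugate linear; complex scalings are
    covered by the same statement. *)
Lemma is_derive_real_linear (L : A -> A) (C : R) (f : R -> V) (t : R) (df : V) :
  {morph L : a b / a - b} ->
  (forall (r : R) a, L (real_complex R r *: a) = real_complex R r *: L a) ->
  (forall a, N (L a) <= C * N a) ->
  is_derive t (1 : R) f df ->
  is_derive t (1 : R) ((fun s => L (f s)) : R -> V) (L df).
Proof.
move=> LB LZ Lb /is_derive_cvg cf; apply/is_derive_cvg.
have nf : `|h^-1 *: (f (h + t) - f t) - df| @[h --> 0^'] --> (0 : R).
  exact/norm_cvg0P/subr_cvg0.
apply/subr_cvg0/norm_cvg0P.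
pose bound h : R := C * `|h^-1 *: (f (h + t) - f t) - df|.
apply: (@squeeze_cvgr _ _ _ _ (cst 0) bound).
- near=> h; rewrite normr_ge0 /=.
  rewrite banach_scaleE -[(L _ - L _ : A)]LB -LZ -LB.
  exact: Lb.
- exact: cvg_cst.
- rewrite /bound -[X in _ --> X](_ : C * 0 = 0 :> R); last by rewrite mulr0.
  by apply: cvgM => //; exact: cvg_cst.
Unshelve. all: by end_near. Qed.

Lemma is_derive_star (f : R -> V) (t : R) (df : V) :
  is_derive t (1 : R) f df ->
  is_derive t (1 : R) ((fun s => star (f s : A)) : R -> V) (star (df : A)).
Proof.
apply: (@is_derive_real_linear _ 1); first exact: starB; first exact: starZr.
by move=> a; rewrite mul1r cstar_norm_star.
Qed.

Lemma is_derive_cscale (z : R[i]) (f : R -> V) (t : R) (df : V) :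
  is_derive t (1 : R) f df ->
  is_derive t (1 : R) ((fun s => z *: (f s : A)) : R -> V) (z *: (df : A)).
Proof.
apply: (@is_derive_real_linear _ (Normc.normc z)).
- by move=> a b; rewrite scalerBr.
- by move=> r a; rewrite !scalerA mulrC.
- by move=> a; rewrite cstar_normZ.
Qed.

Lemma is_derive_cRe (f : R -> V) (t : R) (df : V) :
  is_derive t (1 : R) f df ->
  is_derive t (1 : R) ((fun s => cRe (f s : A)) : R -> V) (cRe (df : A)).
Proof.
by move=> dfE; apply: is_derive_cscale; apply: is_deriveD => //;
  exact: is_derive_star.
Qed.

Lemma is_derive_cIm (f : R -> V) (t : R) (df : V) :
  is_derive t (1 : R) f df ->
  is_derive t (1 : R) ((fun s => cIm (f s : A)) : R -> V) (cIm (df : A)).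
Proof.
by move=> dfE; apply: is_derive_cscale; apply: is_deriveB => //;
  exact: is_derive_star.
Qed.

End BanachAlgebraDerivatives.

Section MatrixDerivatives.

(** * Entrywise differentiation of matrices *)

Variables (R : realType) (A : cstarAlgType R).
Local Notation V := (banach A).
Implicit Types (f g : R -> 'M[A]_2) (X Y : 'M[A]_2) (t : R).

Lemma is_derive_mulr_cst (f : R -> V) t (df : V) (a : A) :
  is_derive t (1 : R) f df ->
  is_derive t (1 : R) ((fun s => (f s : A) * a) : R -> V) ((df : A) * a).
Proof.
move=> dfE; apply: is_derive_eq.
  by apply: (is_derive_cstarM dfE (is_derive_cst (a : V) t (1 : R))).
by rewrite mulr0 addr0.
Qed.

Lemma mx_is_deriveM f g t X Y : mx_is_derive f t X -> mx_is_derive g t Y ->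
  mx_is_derive (fun s => f s * g s) t (X * g t + f t * Y).
Proof.
move=> dX dY i j.
have -> : (fun s => (f s * g s) i j : V) =
    (fun s => f s i 0 * g s 0 j : V) + (fun s => f s i 1 * g s 1 j : V).
  by apply/funext => s; rewrite mulr2E.
apply: is_derive_eq.
  by apply: is_deriveD; apply: is_derive_cstarM.
by rewrite mxE !mulr2E addrACA.
Qed.

Lemma mx_is_derive_mx2 (a b c d : R -> V) t (a' b' c' d' : V) :
  is_derive t (1 : R) a a' -> is_derive t (1 : R) b b' ->
  is_derive t (1 : R) c c' -> is_derive t (1 : R) d d' ->
  mx_is_derive (fun s => mx2 (a s : A) (b s : A) (c s : A) (d s : A)) t
    (mx2 (a' : A) (b' : A) (c' : A) (d' : A)).
Proof.
by move=> *; do 2!apply: ord2P;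
  rewrite mxE; under eq_fun do rewrite mxE.
Qed.

Lemma mx_is_derive_near_eq f g t X : (\forall s \near t, f s = g s) ->
  mx_is_derive f t X -> mx_is_derive g t X.
Proof.
move=> fg dX i j; apply: near_eq_is_derive (dX i j).
by apply: filterS fg => s ->.
Qed.

Lemma mx_is_derive_unique f t X Y :
  mx_is_derive f t X -> mx_is_derive f t Y -> X = Y.
Proof.
by move=> dX dY; apply/matrixP => i j; exact: is_derive_unique (dX i j) (dY i j).
Qed.

End MatrixDerivatives.

Section ConnectionForm.

(** * The differential of the orbit map *)

Variables (R : realType) (A : cstarAlgType R).
Local Notation V := (banach A).
Implicit Types (a b c d h s v x y : A) (X : 'M[A]_2).

Lemma is_derive_moebius (g : R -> 'M[A]_2) h X :
  g 0 = 1 -> mx_is_derive g 0 X ->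
  is_derive (0 : R) (1 : R) ((fun t => moebius (g t) h) : R -> V)
    (infinitesimal_action h X).
Proof.
move=> g0 dg.
have dn : is_derive (0 : R) (1 : R) ((fun t => g t 1 0 + g t 1 1 * h) : R -> V)
    (X 1 0 + X 1 1 * h) by apply: is_deriveD => //; exact: is_derive_mulr_cst.
have dd : is_derive (0 : R) (1 : R) ((fun t => moebius_denom (g t) h) : R -> V)
    (X 0 0 + X 0 1 * h) by apply: is_deriveD => //; exact: is_derive_mulr_cst.
have d0 : moebius_denom (g 0) h = 1.
  by rewrite /moebius_denom g0 !mxE /= mul0r addr0.
apply: is_derive_eq.
  apply: (is_derive_cstarM dn); apply: is_derive_cstarV dd.
  by rewrite d0 unitr1.
by rewrite /infinitesimal_action d0 g0 !mxE /= invr1 !mulr1 !mul1r add0r mulrN.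
Qed.

Lemma orbit_differential_val h X v : orbit_differential h X v ->
  v = infinitesimal_action h X.
Proof.
by move=> [g [_ g0 dg dm]]; apply: is_derive_unique dm (is_derive_moebius h g0 dg).
Qed.

(* The curve is a product of one-parameter families of lower triangular, upper
   triangular and diagonal isometries. *)
Lemma orbit_differential_lie h X : lie_theta X ->
  orbit_differential h X (infinitesimal_action h X).
Proof.
rewrite (mx2_eta X); move: (X 0 0) (X 0 1) (X 1 0) (X 1 1) => k l m n.
move=> /lie_theta_rel [sl sm nk].
(* An affine curve can stand in for the exponential: the diagonal factor only has to be invertible
   near 0 with velocity k, and [(star (dg t))^-1] then has velocity - star k = n. *)
pose dg (t : R) : V := 1 + t *: (k : V).
have ddg : is_derive (0 : R) (1 : R) dg (k : V).
  apply: is_derive_eq.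
    by apply: (is_deriveD (is_derive_cst (1 : V) _ _) (is_derive_scale _ _)).
  by rewrite add0r.
have dg0 : dg 0 = 1 by rewrite /dg scale0r addr0.
have udg : \forall t \near (0 : R), (dg t : A) \is a GRing.unit.
  have cdg := is_derive_continuous ddg; rewrite dg0 in cdg.
  apply: filterS (unit_near_cvg (unitr1 A) cdg) => t.
  exact/unit_near/unitr1.
pose g (t : R) : 'M[A]_2 := mx2 1 0 (t *: (m : V)) 1 * mx2 1 (t *: (l : V)) 0 1
  * mx2 (dg t : A) 0 0 (star (dg t : A))^-1.
have g0 : g 0 = 1.
  by rewrite /g !scale0r dg0 star1 invr1 mx2_1 !mulr1.
have c0 := is_derive_cst (0 : V) (0 : R) (1 : R).
have c1 := is_derive_cst (1 : V) (0 : R) (1 : R).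
have dgX : mx_is_derive g 0 (mx2 k l m n).
  have dm := mx_is_derive_mx2 c1 c0 (is_derive_scale 0 (m : V)) c1.
  have dl := mx_is_derive_mx2 c1 (is_derive_scale 0 (l : V)) c0 c1.
  have dst : is_derive (0 : R) (1 : R) ((fun t => (star (dg t : A))^-1) : R -> V)
      (- star k).
    apply: is_derive_eq.
      apply: is_derive_cstarV; last exact: is_derive_star.
      by rewrite /= dg0 star1 unitr1.
    by rewrite /= dg0 star1 invr1 mul1r mulr1.
  have dd := mx_is_derive_mx2 ddg c0 c0 dst.
  have := mx_is_deriveM (mx_is_deriveM dm dl) dd.
  rewrite /= !scale0r dg0 star1 invr1 mx2_1 !mulr1 !mul1r !mx2D.
  by rewrite !(addr0, add0r) -nk.
exists g; split=> //.
- apply: filterS udg => t ut; apply: U_theta_mul; last exact: U_theta_diag.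
  by apply: U_theta_mul; [apply: U_theta_lower|apply: U_theta_upper];
    rewrite /selfadjoint banach_scaleE starZr ?sl ?sm.
- exact: is_derive_moebius.
Qed.

End ConnectionForm.

Section CovariantDerivative.

(** * The connection form and its derivative along a curve *)

Variables (R : realType) (A : cstarAlgType R).
Local Notation V := (banach A).
Local Notation half := ((2%:R : R[i])^-1).
Implicit Types (a b h v x y : A) (X : 'M[A]_2).

Lemma translationD x y : translation x * translation y = translation (x + y).
Proof. by rewrite mx2M; congr mx2; nc_ring R A. Qed.

Lemma translationK x : translation x * translation (- x) = 1.
Proof. by rewrite translationD subrr /translation mx2_1. Qed.

Lemma siegel_cIm_unit h : siegel h -> cIm h \is a GRing.unit.
Proof. by case. Qed.

(** By [horizontal_exists] the set of candidates is nonempty, so [xget] does not return its default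
    0. *)
Lemma kappa_facts h v : siegel h ->
  horizontal h (kappa h v) /\ orbit_differential h (kappa h v) v.
Proof.
move=> sh; have [X hX XE] := horizontal_exists v sh.
have dX : orbit_differential h X v.
  by rewrite -XE; apply: orbit_differential_lie; exact: horizontal_lie hX.
exact: (@xgetPex _ 0 [set Y | horizontal h Y /\ orbit_differential h Y v]
  (ex_intro _ X (conj hX dX))).
Qed.

Lemma kappaE h v : siegel h -> kappa h v =
  translation (cRe h) * kappa_mx (cIm h) (cRe v) (cIm v)
  * translation (- cRe h).
Proof.
move=> sh; have [hk dk] := kappa_facts v sh.
have hE := cRe_cIm h.
apply: horizontal_unique; rewrite -?hE -?cRe_cIm //;
  try exact: selfadjoint_cRe; try exact: selfadjoint_cIm.
  exact: siegel_cIm_unit.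
by rewrite -(orbit_differential_val dk).
Qed.

(** The vector [v] is recovered from [kappa h v] as its infinitesimal action. *)
Lemma kappa_inj h : siegel h -> injective (@kappa R A h).
Proof.
move=> sh v w vw; have [_ dv] := kappa_facts v sh.
have [_ dw] := kappa_facts w sh.
by rewrite (orbit_differential_val dv) (orbit_differential_val dw) vw.
Qed.

Definition kappa_mx_deriv y v1 v2 y' v1' v2' : 'M[A]_2 :=
  let Y' := - (y^-1 * y' * y^-1) in
  mx2 (- (half *: (Y' * v2 + y^-1 * v2')))
      (half *: ((Y' * v1 + y^-1 * v1') * y^-1 + y^-1 * v1 * Y'))
      (half *: v1') (half *: (v2' * y^-1 + v2 * Y')).

Lemma mx_is_derive_kappa_mx (y v1 v2 : R -> V) (t : R) (y' v1' v2' : V) :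
  (y t : A) \is a GRing.unit ->
  is_derive t (1 : R) y y' ->
  is_derive t (1 : R) v1 v1' -> is_derive t (1 : R) v2 v2' ->
  mx_is_derive (fun s => kappa_mx (y s : A) (v1 s : A) (v2 s : A)) t
    (kappa_mx_deriv (y t : A) (v1 t : A) (v2 t : A)
       (y' : A) (v1' : A) (v2' : A)).
Proof.
move=> uy dy dv1 dv2; have dY := is_derive_cstarV uy dy.
apply: mx_is_derive_mx2.
- apply: is_deriveN; apply: is_derive_cscale; exact: is_derive_cstarM.
- apply: is_derive_cscale; apply: (is_derive_cstarM _ dY).
  exact: is_derive_cstarM.
- exact: is_derive_cscale.
- by apply: is_derive_cscale; exact: is_derive_cstarM.
Qed.

Lemma mx_is_derive_translation (x : R -> V) (t : R) (x' : V) :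
  is_derive t (1 : R) x x' ->
  mx_is_derive (fun s => translation (x s : A)) t (mx2 0 0 (x' : A) 0).
Proof.
by move=> dx; apply: mx_is_derive_mx2 dx _; exact: is_derive_cst.
Qed.

(* [tx], [ty], [c], [u] are the derivatives of [x], [y] and of the real and
   imaginary parts [v1], [v2] of the field. *)
Lemma covariant_mx_eq y v1 v2 tx ty c u :
  selfadjoint y -> y \is a GRing.unit -> selfadjoint v1 -> selfadjoint v2 ->
  selfadjoint tx -> selfadjoint ty ->
  mx2 0 0 tx 0 * kappa_mx y v1 v2 + kappa_mx_deriv y v1 v2 ty c u
  - kappa_mx y v1 v2 * mx2 0 0 tx 0
  + commutator (kappa_mx y v1 v2) (kappa_mx y tx ty) =
  kappa_mx y (c - cRe (tx * y^-1 * v2 + ty * y^-1 * v1))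
             (u + cRe (tx * y^-1 * v1 - ty * y^-1 * v2)).
Proof.
move=> sy uy sv1 sv2 stx sty.
have sY : star y^-1 = y^-1 by rewrite starV // sy.
rewrite /cRe !(starD, starN, starM) sY sv1 sv2 stx sty.
rewrite /commutator /kappa_mx /kappa_mx_deriv !mx2M !mx2N !mx2D.
by congr mx2; nc_ring R A.
Qed.

(** E stands for the velocity [[0, 0], [x', 0]] of the translation. It absorbs translations on both
    sides, so the whole defining expression is conjugate to one in which [x] no longer appears
    outside the conjugation. *)
Lemma covariant_conj x E M M' N :
  E * translation (- x) = E -> translation x * E = E ->
  (E * M + translation x * M') * translation (- x)
    + translation x * M * (- E)
    + commutator (translation x * M * translation (- x))
                 (translation x * N * translation (- x)) =
  translation x * (E * M + M' - M * E + commutator M N) * translation (- x).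
Proof.
move=> El Er; have K := translationK (- x); rewrite opprK in K.
have conj P Q : translation x * P * translation (- x)
    * (translation x * Q * translation (- x))
    = translation x * (P * Q) * translation (- x).
  by rewrite !mulrA -(mulrA _ (translation (- x))) K mulr1.
rewrite /commutator !conj -mulrBl -mulrBr.
rewrite !(mulrDl, mulrDr) !mulrN !mulNr.
by rewrite !mulrA Er -[in RHS](mulrA _ E) El.
Qed.

Lemma mx_is_derive_kappa (h z : R -> V) (dh dz : V) :
  is_derive (0 : R) (1 : R) h dh -> is_derive (0 : R) (1 : R) z dz ->
  (\forall t \near (0 : R), siegel (h t : A)) -> siegel (h 0 : A) ->
  mx_is_derive (fun t => kappa (h t : A) (z t : A)) 0
   ((mx2 0 0 (cRe (dh : A)) 0
       * kappa_mx (cIm (h 0 : A)) (cRe (z 0 : A)) (cIm (z 0 : A))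
     + translation (cRe (h 0 : A))
       * kappa_mx_deriv (cIm (h 0 : A)) (cRe (z 0 : A)) (cIm (z 0 : A))
           (cIm (dh : A)) (cRe (dz : A)) (cIm (dz : A)))
      * translation (- cRe (h 0 : A))
    + translation (cRe (h 0 : A))
       * kappa_mx (cIm (h 0 : A)) (cRe (z 0 : A)) (cIm (z 0 : A))
      * - mx2 0 0 (cRe (dh : A)) 0).
Proof.
move=> dhE dzE sh sh0.
pose F t := translation (cRe (h t : A))
   * kappa_mx (cIm (h t : A)) (cRe (z t : A)) (cIm (z t : A))
   * translation (- cRe (h t : A)).
apply: (@mx_is_derive_near_eq _ _ F).
  by apply: filterS sh => t st; rewrite /F -kappaE.
have dx := is_derive_cRe dhE.
have dm := mx_is_derive_kappa_mx (siegel_cIm_unit sh0) (is_derive_cIm dhE)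
  (is_derive_cRe dzE) (is_derive_cIm dzE).
have dl := mx_is_derive_translation (is_deriveN dx).
have := mx_is_deriveM (mx_is_deriveM (mx_is_derive_translation dx) dm) dl.
by rewrite -[mx2 0 0 (- _) 0]/(mx2 0 0 (- _) 0) mx2N !oppr0.
Qed.

End CovariantDerivative.

Theorem mainTheorem18 (R : realType) (A : cstarAlgType R)
    (h0 x0 y0 : A)
    (I : set R) (h x y : R -> A)
    (U : set A) (zeta chi Upsilon : A -> A)
    (h0_in : siegel h0)
    (x0_sa : selfadjoint x0) (y0_sa : selfadjoint y0)
    (h0E : h0 = x0 + ('i : R[i]) *: y0)
    (I_open : open I) (I_itv : is_interval I) (I0 : I 0)
    (h_smooth : smooth_on I (h : R -> banach A))
    (h_in : forall t : R, I t -> siegel (h t))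
    (hE : forall t : R, I t ->
       [/\ selfadjoint (x t), selfadjoint (y t) &
           h t = x t + ('i : R[i]) *: y t])
    (h_0 : h 0 = h0)
    (U_open : open (U : set (banach A))) (U_h0 : U h0)
    (U_in : U `<=` @siegel R A)
    (zeta_smooth : smooth_on (U : set (banach A))
                             (zeta : banach A -> banach A))
    (zetaE : forall k : A, U k ->
       [/\ selfadjoint (chi k), selfadjoint (Upsilon k) &
           zeta k = chi k + ('i : R[i]) *: Upsilon k]) :
  let x' : A := derive1 (x : R -> banach A) 0 in
  let y' : A := derive1 (y : R -> banach A) 0 in
  let zeta' : A := derive1 (fun t : R => zeta (h t) : banach A) 0 in
  forall D : A,
    is_covariant_derivative h zeta D <->
    D = zeta' - cRe (x' * y0^-1 * Upsilon h0 + y' * y0^-1 * chi h0)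
        + ('i : R[i]) *: cRe (x' * y0^-1 * chi h0 - y' * y0^-1 * Upsilon h0).
Proof.
have [dh dhE] := smooth_on_comp_derive h_smooth I_open I0 (is_derive_id (0 : R) 1).
have {}dhE : is_derive (0 : R) (1 : R) (h : R -> banach A) dh := dhE.
have U0 : U (h 0) by rewrite h_0.
have [dz dzE] := smooth_on_comp_derive zeta_smooth U_open U0 dhE.
have nearI : \forall t \near (0 : R), I t by exact: open_nbhs_nbhs.
(* x and y are tied to h on I only, hence the passage through values near 0. *)
have xE : derive1 (x : R -> banach A) 0 = cRe (dh : A).
  apply: derive1_val; apply: near_eq_is_derive (is_derive_cRe dhE).
  by apply: filterS nearI => t /hE [sx sy ->] /=; rewrite cRe_sa.
have yE : derive1 (y : R -> banach A) 0 = cIm (dh : A).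
  apply: derive1_val; apply: near_eq_is_derive (is_derive_cIm dhE).
  by apply: filterS nearI => t /hE [sx sy ->] /=; rewrite cIm_sa.
have [schi sUps zE] := zetaE _ U_h0.
move=> x' y' zeta' D; rewrite /x' /y' xE yE.
have -> : zeta' = dz by apply: derive1_val.
have dh1 : derive1 (h : R -> banach A) 0 = dh by apply: derive1_val.
have y0E : cIm h0 = y0 by rewrite h0E cIm_sa.
set Y := cRe (_ + _); set X := cRe (_ - _).
have sX : selfadjoint X by exact: selfadjoint_cRe.
have sY : selfadjoint Y by exact: selfadjoint_cRe.
set D0 := dz - Y + _.
have D0E : D0 = (cRe (dz : A) - Y) + 'i *: (cIm (dz : A) + X).
  by rewrite /D0 {1}(cRe_cIm (dz : A)); nc_ring R A.
have sRe : selfadjoint (cRe (dz : A) - Y).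
  by rewrite /selfadjoint starB selfadjoint_cRe sY.
have sIm : selfadjoint (cIm (dz : A) + X).
  by rewrite /selfadjoint starD selfadjoint_cIm sX.
have nearS : \forall t \near (0 : R), siegel (h t) by apply: filterS nearI.
have dK := mx_is_derive_kappa dhE dzE nearS (h_in _ I0).
move: dK; set K0 := (_ + _ : 'M[A]_2) => dK.
have K0E : kappa h0 D0 = K0 + commutator (kappa (h 0) (zeta (h 0)))
    (kappa (h 0) (derive1 (h : R -> banach A) 0)).
  rewrite dh1 h_0 !kappaE // /K0 /= h_0 covariant_conj.
  - rewrite covariant_mx_eq ?y0E //.
    + by rewrite D0E cRe_sa // cIm_sa // zE cRe_sa // cIm_sa.
    + by rewrite -y0E; exact: siegel_cIm_unit.
    + exact: selfadjoint_cRe.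
    + exact: selfadjoint_cIm.
    + exact: selfadjoint_cRe.
    + exact: selfadjoint_cIm.
  - by rewrite mx2M; congr mx2; nc_ring R A.
  - by rewrite mx2M; congr mx2; nc_ring R A.
split=> [[K [dK' KE]]|->].
  (* The derivatives K and K0 of the same curve coincide, so [D] and [D0] have the same image under
     [kappa h0]. *)
  apply: (kappa_inj h0_in); rewrite -{1}h_0 KE K0E; congr (_ + _).
  exact: mx_is_derive_unique dK' dK.
by exists K0; split; [exact: dK|rewrite -K0E h_0].
Qed.
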